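(* Let $\alpha\in(2,\infty)\cap\mathbb{Z}$ and let $k\ge 2$ be a fixed integer. In the Chung--Lu random graph on $n\ge k$ nodes with i.i.d. weights having tail $\overline{F}(h)=\mathbb{P}(H>h)=h^{1-\alpha}l(h)$, $h\ge 1$, where $l$ is a fixed slowly varying function and $F=1-\overline{F}$, let $K_k$ be the event that the nodes $\{1,2,\ldots,k\}$ form a clique. For $x\ge 1$ let $$Q(x)=\int_1^{x}h^{\alpha-1}\,dF(h).$$ Then, as $n\to\infty$: \begin{itemize} \item if $k<\alpha$, then $\mathbb{P}(K_k)\asymp n^{\frac{k}{2}(1-k)}$; \item if $k=\alpha$, then $\mathbb{P}(K_k)\lesssim n^{\frac{k}{2}(1-k)}\,Q(\sqrt{n})^{k-1}\,Q(n)$; \item if $k>\alpha$, then $\mathbb{P}(K_k)\lesssim n^{\frac{k}{2}(1-\alpha)}\,l(\sqrt{n})^{\alpha-1}\,Q(n)^{k-\alpha+1}$. \end{itemize}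
   Context: Model (Chung--Lu variant of the rank-1 inhomogeneous random graph). There are $n$ nodes $1,\ldots,n$. Node $i$ has weight $H_i$, where $(H_1,\ldots,H_n)$ are i.i.d. copies of a random variable $H$ taking values in $[1,\infty)$ with distribution function $F=1-\overline{F}$ and $\overline{F}(h)=\mathbb{P}(H>h)=h^{1-\alpha}l(h)$ for $h\ge 1$, where $\alpha>2$ and $l$ is a (positive) slowly varying function, i.e. $\lim_{x\to\infty} l(\lambda x)/l(x)=1$ for every $\lambda>0$. Integrals $\int_1^x\cdot\,dF(h)$ are Lebesgue--Stieltjes integrals over $[1,x]$, i.e. $\int_1^x\phi(h)\,dF(h)=\mathbb{E}[\phi(H)\mathbf{1}(H\le x)]$. Put $\mu=\mathbb{E}(H)$. Conditional on the weights being $h_1,\ldots,h_n$, each pair of distinct nodes $(i,j)$ is joined by an edge, independently of everything else, with probability $p_{i,j}=\min\{h_ih_j/(\mu n),1\}$. The parameters $\alpha,\mu,k$ and the function $l$ are fixed as $n\to\infty$. A set of nodes forms a clique if all pairs of distinct nodes in it are joined by edges. Notation: $f(n)\asymp g(n)$ means there exist $n_0\ge 0$ and constants $0<C_1<C_2<\infty$ such that $C_1g(n)\le f(n)\le C_2g(n)$ for all $n>n_0$. $f(n)\lesssim g(n)$ means there exist $n_0\ge0$ and a function $h(n)$ with $h(n)\asymp g(n)$ and $f(n)\le h(n)$ for all $n>n_0$. *)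

(* Defs.v *)
From HB Require Import structures.
From mathcomp Require Import all_boot all_order all_algebra.
From mathcomp Require Import all_classical all_reals all_analysis.

Set Implicit Arguments.
Unset Strict Implicit.
Unset Printing Implicit Defensive.

Import Order.TTheory GRing.Theory Num.Theory.
Import numFieldNormedType.Exports.

Local Open Scope classical_set_scope.
Local Open Scope ring_scope.

Definition asymp (R : realType) (f g : nat -> R) : Prop :=
  exists (n0 : nat) (C1 C2 : R), 0 < C1 /\ C1 < C2 /\
    forall n, (n0 < n)%N -> C1 * g n <= f n /\ f n <= C2 * g n.

Definition lesssim (R : realType) (f g : nat -> R) : Prop :=
  exists (n0 : nat) (h : nat -> R), asymp h g /\
    forall n, (n0 < n)%N -> f n <= h n.

(* l need only be meaningful on [1, +oo[; its values elsewhere are irrelevant. *)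
Definition slowly_varying (R : realType) (l : R -> R) : Prop :=
  (forall x, 1 <= x -> 0 < l x) /\
  (forall lambda, 0 < lambda -> l (lambda * x) / l x @[x --> +oo] --> (1 : R)).

Section Probability.
Context {d : measure_display} {T : measurableType d} {R : realType}.
Variable P : probability T R.

Definition mutually_independent (I : finType) (X : I -> {RV P >-> R}) : Prop :=
  forall (J : {set I}) (B : I -> set R), (forall i, measurable (B i)) ->
    P (\bigcap_(i in [set` J]) X i @^-1` B i) =
    \big[*%E/1%E]_(i in J) P (X i @^-1` B i).

Definition iid_copies {d0 : measure_display} {T0 : measurableType d0}
    {P0 : probability T0 R} (H : {RV P0 >-> R})
    (I : finType) (X : I -> {RV P >-> R}) : Prop :=
  mutually_independent X /\
  forall i (B : set R), measurable B ->
    distribution P (X i) B = distribution P0 H B.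

Definition sigma_generated (I : finType) (X : I -> {RV P >-> R}) :
    set_system T :=
  <<s [set A | exists i (B : set R), measurable B /\ A = X i @^-1` B] >>.

(* f is a version of the conditional probability P(A | G). *)
Definition is_cond_prob (G : set_system T) (A : set T) (f : T -> R) : Prop :=
  (forall B : set R, measurable B -> G (f @^-1` B)) /\
  (forall B : set T, G B -> P (B `&` A) = (\int[P]_(w in B) (f w)%:E)%E).

End Probability.

Definition is_clique (V : finType) (e : rel V) (A : {set V}) : Prop :=
  {in A &, forall i j, i != j -> e i j}.

Definition edge_prob (R : realType) (mu : R) (n : nat) (x y : R) : R :=
  Num.min (x * y / (mu * n%:R)) 1.

(* The edge set is a random simple graph G on 'I_n.  The last clause says that,
   given the weights, the edges {i, j} (each represented by the pair with
   i < j) are mutually independent and {i, j} is present with probability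
   edge_prob mu n (W i) (W j): the product rule is required for every finite
   family S of edges, singletons included. *)
Definition chung_lu {d0 : measure_display} {T0 : measurableType d0}
    {R : realType} {P0 : probability T0 R} (H : {RV P0 >-> R}) (mu : R)
    (n : nat) {d : measure_display} {T : measurableType d}
    (P : probability T R)
    (W : 'I_n -> {RV P >-> R}) (G : T -> rel 'I_n) : Prop :=
  [/\ iid_copies H W,
      (forall w, symmetric (G w) /\ irreflexive (G w)),
      (forall i j, measurable [set w | G w i j]) &
      (forall S : {set 'I_n * 'I_n}, (forall p, p \in S -> (p.1 < p.2)%N) ->
         is_cond_prob P (sigma_generated W)
           (\bigcap_(p in [set` S]) [set w | G w p.1 p.2])
           (fun w => \prod_(p in S) edge_prob mu n (W p.1 w) (W p.2 w)))].

(* The nodes 1, ..., k are the elements 0, ..., k - 1 of 'I_n. *)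
Definition clique_event (T : Type) (k n : nat) (G : T -> rel 'I_n) : set T :=
  [set w | is_clique (G w) [set i : 'I_n | (i < k)%N]%SET].

(* The Lebesgue-Stieltjes measure dF is the law of H. *)
Definition truncated_moment {d0 : measure_display} {T0 : measurableType d0}
    {R : realType} {P0 : probability T0 R} (H : {RV P0 >-> R})
    (alpha : nat) (x : R) : R :=
  \int[distribution P0 H]_(h in `[1, x]) (h ^+ (alpha - 1)).

(* Main.v *)
Require Import Defs.
From HB Require Import structures.
From mathcomp Require Import all_boot all_order all_algebra.
From mathcomp Require Import all_classical all_reals all_analysis.
From mathcomp Require Import measurable_realfun ring lra.

Set Implicit Arguments.
Unset Strict Implicit.
Unset Printing Implicit Defensive.

Import Order.TTheory GRing.Theory Num.Theory.
Import numFieldNormedType.Exports.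

Local Open Scope classical_set_scope.
Local Open Scope ring_scope.

(** Write r = sqrt n, a = alpha - 1 and l(x) = x^a P(H > x). The mean mu of H is
    at least 1, so an edge between nodes of weights x and y has probability at
    most min(x y / r^2, 1), and the clique probability is the expectation of
    the product of the edge probabilities over the pairs among the first k
    nodes ([clique_probE]).

    The point is to bound this product by a product over nodes, so that
    independence turns its expectation into a product of one-dimensional
    truncated moments. Each edge bound is shared between its two endpoints
    ([share], [prod_edges]), every endpoint receiving its weight divided by r.

    When k < alpha, each edge is at most (X_i / r)(X_j / r) with X = min(H, n),
    and a node contributes (X_i / r)^(k-1). The moment of order k - 1 < a is
    bounded, which gives the upper bound r^(-k(k-1)); since all weights are at
    least 1, each edge has probability at least 1/(mu n), which gives the lower
    bound of the same order.

    When k >= alpha, split according to the set S of nodes of weight more than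
    r, and let t be the number of remaining, light, nodes. Two heavy nodes are
    joined with bound 1, two light nodes with bound x y / r^2. A heavy node
    uses its edges to a set J of only min(t, a) light nodes, and bounds the
    others by 1: with more edges its truncated moment would be too large, and
    with a edges that moment is about Q(n). The nodes then contribute
      (X_i / r)^|J| on S, (H_i / r)^(k-1) on J, (H_i / r)^(t-1) elsewhere,
    and every one of these has expectation at most a constant times r^(-a)
    times a slowly varying quantity: l(r) on J (or Q(r) when k = alpha), Q(n)
    elsewhere, and l(r) everywhere when t < a ([EH_node_factor_le]). As |J| = a
    in the main case, the product over the k nodes is
    r^(-a k) l(r)^a Q(n)^(k-a), and l <= 3 Q takes care of the case t < a
    ([clique_prob_le_split]).

    The moment estimates ([karamata_lower], [karamata_upper],
    [slow_part_le_trunc_mom]) are Karamata's theorem in the integer case; they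
    follow by induction along x, 2x, 4x, ... from the fact that l(2x) / l(x) is
    eventually within [3/4, 3/2]. *)

(** * Bounded nonnegative measurable functions *)

Section bounded_functions.
Context {d : measure_display} {T : measurableType d} {R : realType}.
Implicit Types (f g : T -> R).

(** Apart from the mean itself, every moment below is truncated, so that only
    expectations of such functions occur: they are finite, and linearity and
    monotonicity hold without integrability conditions. *)
Definition bounded_mfun_ge0 f : Prop :=
  [/\ measurable_fun setT f, forall x, 0 <= f x & exists M, forall x, f x <= M].

Lemma bmf_cst (c : R) : 0 <= c -> bounded_mfun_ge0 (cst c).
Proof. by move=> c0; split=> //; exists c. Qed.

Lemma bmf_indic (A : set T) : measurable A -> bounded_mfun_ge0 (\1_A).
Proof.
move=> mA; split; first exact: measurable_indic.
  by move=> x; rewrite indicE ler0n.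
by exists 1 => x; rewrite indicE; case: (_ \in _); rewrite ?ler01 ?lexx.
Qed.

Lemma bmfM f g : bounded_mfun_ge0 f -> bounded_mfun_ge0 g ->
  bounded_mfun_ge0 (fun x => f x * g x).
Proof.
move=> [mf f0 [M fM]] [mg g0 [N gN]]; split.
- exact: measurable_funM.
- by move=> x; rewrite mulr_ge0.
- by exists (M * N) => x; rewrite ler_pM.
Qed.

Lemma bmf_prod (I : finType) (A : {set I}) (f : I -> T -> R) :
  (forall i, i \in A -> bounded_mfun_ge0 (f i)) ->
  bounded_mfun_ge0 (fun x => \prod_(i in A) f i x).
Proof.
move=> bf.
have -> : (fun x => \prod_(i in A) f i x) =
    (fun x => \prod_(i <- enum A) f i x).
  by apply/funext => x; rewrite big_enum.
have : forall i, i \in enum A -> bounded_mfun_ge0 (f i) by move=> i; rewrite mem_enum; exact: bf.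
elim: (enum A) => [_|i s IH H].
  have -> : (fun x : T => \prod_(i <- [::]) f i x) = cst 1.
    by apply/funext => x; rewrite big_nil.
  exact: bmf_cst.
have -> : (fun x : T => \prod_(j <- i :: s) f j x) =
    (fun x => f i x * \prod_(j <- s) f j x).
  by apply/funext => x; rewrite big_cons.
apply: bmfM; first by apply: H; rewrite mem_head.
by apply: IH => j js; apply: H; rewrite inE js orbT.
Qed.

Variable P : probability T R.

Lemma bmf_integrable f : bounded_mfun_ge0 f -> P.-integrable setT (EFin \o f).
Proof.
move=> [mf f0 [M fM]]; apply: measurable_bounded_integrable => //.
  by rewrite (le_lt_trans (probability_le1 P _)) ?ltry.
exists M; split; first by rewrite num_real.
by move=> y My x _ /=; rewrite ger0_norm// (le_trans (fM x))// ltW.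
Qed.

Lemma bmf_EFin_Rintegral f : bounded_mfun_ge0 f ->
  (\int[P]_x f x)%:E = (\int[P]_x (f x)%:E)%E.
Proof.
by move=> bf; rewrite fineK//; exact/integrable_fin_num/bmf_integrable.
Qed.

Lemma bmf_le f g : bounded_mfun_ge0 f -> bounded_mfun_ge0 g ->
  (forall x, f x <= g x) ->
  \int[P]_x f x <= \int[P]_x g x.
Proof. by move=> bf bg fg; apply: le_Rintegral => //; exact: bmf_integrable. Qed.

Lemma Rintegral_indic (A : set T) : measurable A ->
  \int[P]_x \1_A x = fine (P A).
Proof. by move=> mA; rewrite /Rintegral integral_indic// setIT. Qed.

Lemma bmf_sum (I : Type) (s : seq I) (f : I -> T -> R) :
  (forall i, bounded_mfun_ge0 (f i)) ->
  bounded_mfun_ge0 (fun x => \sum_(i <- s) f i x).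
Proof.
move=> bf; elim: s => [|i s [mf f0 [M fM]]].
  under eq_fun do rewrite big_nil.
  exact: bmf_cst.
under eq_fun do rewrite big_cons.
have [mi i0 [N iN]] := bf i; split.
- exact: measurable_funD.
- by move=> x; rewrite addr_ge0.
- by exists (N + M) => x; rewrite lerD.
Qed.

Lemma Rintegral_bmf_sum (I : Type) (s : seq I) (f : I -> T -> R) :
  (forall i, bounded_mfun_ge0 (f i)) ->
  \int[P]_x (\sum_(i <- s) f i x) = \sum_(i <- s) \int[P]_x f i x.
Proof.
move=> bf; elim: s => [|i s IH].
  under eq_Rintegral do rewrite big_nil.
  by rewrite big_nil Rintegral_cst// mul0r.
under eq_Rintegral do rewrite big_cons.
rewrite big_cons RintegralD ?IH//; apply: bmf_integrable => //.
exact: bmf_sum.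
Qed.

End bounded_functions.

Lemma bmf_comp d d' (T : measurableType d) (T' : measurableType d')
    (R : realType) (f : T' -> R) (X : T -> T') :
  bounded_mfun_ge0 f -> measurable_fun setT X -> bounded_mfun_ge0 (f \o X).
Proof.
move=> [mf f0 [M fM]] mX; split; [exact: measurableT_comp|by move=> x /=|].
by exists M => x /=.
Qed.

(** * Products of functions of independent random variables *)

Section product_rule.
Import HBNNSimple.
Context d (T : measurableType d) (R : realType) (P : probability T R).

(** A monotone class argument: simple functions are combinations of
    indicators, and increasing limits of simple functions pass through both
    expectations. *)
Lemma expectation_mul_ext (X : {RV P >-> R}) (Y : T -> R) (c : R) : bounded_mfun_ge0 Y ->
  (forall B : set R, measurable B ->
     \int[P]_w (Y w * \1_B (X w)) = c * \int[P]_w \1_B (X w)) ->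
  forall f : R -> R, bounded_mfun_ge0 f ->
    \int[P]_w (Y w * f (X w)) = c * \int[P]_w f (X w).
Proof.
move=> bY H f bf.
have mX : measurable_fun setT (X : T -> R) by [].
have [mf f0 _] := bf; have [mY Y0 _] := bY.
have mEf : measurable_fun setT (EFin \o f) by exact/measurable_EFinP.
pose g := nnsfun_approx measurableT mEf.
have bg n : bounded_mfun_ge0 (g n).
  split=> //; have [M [_ gM]] := simple_bounded (g n); exists (M + 1) => x.
  by apply: (le_trans (ler_norm _)); apply: gM => //; rewrite ltrDl.
have gE n x : g n x = \sum_(r <- finmap.enum_fset (fset_set (range (g n))))
    `|r| * \1_(g n @^-1` [set r]) x.
  rewrite fimfunE fsbig_finite//=; apply: eq_big_seq => r.
  by rewrite in_fset_set// inE => -[y _ <-]; rewrite ger0_norm.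
have bterm (r : R) n : bounded_mfun_ge0 (fun w => `|r| * \1_(g n @^-1` [set r]) (X w)).
  apply: (bmfM (bmf_cst (normr_ge0 r))).
  exact: (bmf_comp (bmf_indic (measurable_sfunP (g n) _))).
have Hg n : \int[P]_w (Y w * g n (X w)) = c * \int[P]_w g n (X w).
  under eq_Rintegral do rewrite gE mulr_sumr.
  under [in RHS]eq_Rintegral do rewrite gE.
  rewrite !Rintegral_bmf_sum//; last by move=> r; exact: bmfM.
  rewrite mulr_sumr; apply: eq_bigr => r _.
  under eq_Rintegral do rewrite mulrCA.
  have mr : measurable (g n @^-1` [set r]) by exact: measurable_sfunP.
  have bi : bounded_mfun_ge0 (fun w => \1_(g n @^-1` [set r]) (X w) : R).
    exact: (bmf_comp (bmf_indic mr)).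
  rewrite !RintegralZl ?H//; first by rewrite mulrCA.
  - exact: bmf_integrable.
  - by apply: bmf_integrable; exact: bmfM.
have lim (Z : T -> R) : bounded_mfun_ge0 Z -> \int[P]_w (Z w * g n (X w)) @[n --> \oo] -->
    \int[P]_w (Z w * f (X w)).
  move=> bZ; have [mZ Z0 _] := bZ.
  have bZg n : bounded_mfun_ge0 (fun w => Z w * g n (X w)).
    by apply: bmfM => //; exact: (bmf_comp (bg n)).
  have bZf : bounded_mfun_ge0 (fun w => Z w * f (X w)).
    by apply: bmfM => //; exact: (bmf_comp bf).
  have mZg n : measurable_fun setT (fun w => (Z w * g n (X w))%:E).
    by have [+ _ _] := bZg n => /measurable_EFinP.
  have Zg0 n w : setT w -> (0 <= (Z w * g n (X w))%:E)%E.
    by move=> _; have [_ + _] := bZg n; rewrite lee_fin; exact.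
  have Zgnd w : setT w -> nondecreasing_seq (fun n => (Z w * g n (X w))%:E).
    move=> _ m n mn; rewrite lee_fin ler_wpM2l//.
    by have /lefP := nd_nnsfun_approx measurableT mEf mn; exact.
  have := @cvg_monotone_convergence _ _ _ P _ measurableT _ mZg Zg0 Zgnd.
  rewrite (_ : (\int[P]_w _ = (\int[P]_w (Z w * f (X w)))%:E)%E).
    by move/fine_cvg.
  rewrite bmf_EFin_Rintegral//; apply: eq_integral => w _.
  apply/cvg_lim => //.
  under eq_fun do rewrite EFinM.
  rewrite EFinM; apply: cvgeZl => //.
  by apply: (cvg_nnsfun_approx measurableT mEf) => // ? _; rewrite lee_fin.
have l1 := lim _ bY.
have l2 : \int[P]_w (Y w * g n (X w)) @[n --> \oo] --> c * \int[P]_w f (X w).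
  under eq_fun do rewrite Hg.
  apply: cvgZr.
  have := lim _ (bmf_cst ler01).
  under eq_fun do under eq_Rintegral do rewrite mul1r.
  by under eq_Rintegral do rewrite mul1r.
exact: (cvg_unique _ l1 l2).
Qed.

(** Independence is the product rule for indicators. The indicators are replaced
    by general functions one index at a time, [expectation_mul_ext] being applied
    with Y the product over the other indices. *)
Lemma independent_expectation_prod (I : finType) (X : I -> {RV P >-> R})
    (V : {set I}) (f : I -> R -> R) :
  mutually_independent X -> (forall i, bounded_mfun_ge0 (f i)) ->
  \int[P]_w (\prod_(i in V) f i (X i w)) = \prod_(i in V) \int[P]_w f i (X i w).
Proof.
move=> indX; have mX i : measurable_fun setT (X i : T -> R) by [].
(* s lists the indices at which the function is allowed to be general *)
suff H (s : seq I) : forall f : I -> R -> R, (forall i, bounded_mfun_ge0 (f i)) ->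
    (forall i, i \in V -> i \notin s -> exists2 B : set R, measurable B & f i = \1_B) ->
    \int[P]_w (\prod_(i in V) f i (X i w)) =
    \prod_(i in V) \int[P]_w f i (X i w).
  by move=> bf; apply: (H (enum I)) => // i _; rewrite mem_enum.
elim: s => [|j s IH] {}f bf fB.
  have /choice[B HB] i : exists B : set R,
      measurable B /\ (i \in V -> f i = \1_B).
    have [iV|_] := boolP (i \in V); last by exists set0.
    by have [B mB fiB] := fB i iV isT; exists B.
  have mB i : measurable (B i) by have [] := HB i.
  have fBE i : i \in V -> f i = \1_(B i) by have [] := HB i.
  have mXB i : measurable (X i @^-1` B i) by exact: measurable_funPTI.
  have -> : \int[P]_w (\prod_(i in V) f i (X i w)) =
      \int[P]_w \1_(\bigcap_(i in [set` V]) X i @^-1` B i) w.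
    apply: eq_Rintegral => w _; rewrite (eq_bigr _ (fun i iV => congr1 (@^~ (X i w)) (fBE i iV))).
    rewrite [RHS]indicE; case: (boolP (w \in _)) => [/set_mem wB|wB].
      rewrite big1// => i iV; rewrite indicE mem_set//; exact: wB.
    have [i iV Bi] : exists2 i, i \in V & ~ B i (X i w).
      apply: contrapT => nex; move: wB; rewrite notin_setE; apply => i /= iV.
      by apply: contrapT => nB; apply: nex; exists i.
    by rewrite (bigD1 i)//= indicE memNset// mul0r.
  rewrite Rintegral_indic; last first.
    by apply: fin_bigcap_measurable => //; exact: finite_finset.
  rewrite (indX V B)//; rewrite (eq_bigr (fun i => (\int[P]_w f i (X i w))%:E)).
    by rewrite prodEFin.
  move=> i iV; rewrite fBE//.
  rewrite -[LHS]fineK ?fin_num_measure//; congr EFin.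
  rewrite -Rintegral_indic//.
have [jV|jV] := boolP (j \in V); last first.
  apply: IH => // i iV nis; apply: fB => //; rewrite inE negb_or nis andbT.
  by apply: contraNneq jV => <-.
pose Y w := \prod_(i in V :\ j) f i (X i w).
have bY : bounded_mfun_ge0 Y by apply: bmf_prod => i _; exact: (bmf_comp (bf i)).
rewrite [RHS](big_setD1 j)//= mulrC.
under eq_Rintegral do rewrite (big_setD1 j)//= mulrC.
apply: (expectation_mul_ext bY) => // B mB.
pose f' i := if i == j then \1_B else f i.
have f'E i : i \in V :\ j -> f' i = f i.
  by rewrite !inE /f' => /andP[/negbTE ->].
have f'j : f' j = \1_B by rewrite /f' eqxx.
have := IH f'; rewrite (big_setD1 j)//= f'j mulrC.
rewrite (eq_bigr (fun i => \int[P]_w f i (X i w))); last first.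
  by move=> i iV; rewrite f'E.
move=> <-; first last.
- move=> i iV nis; rewrite /f'; case: eqP => [_|/eqP ij]; first by exists B.
  by apply: fB => //; rewrite inE negb_or ij.
- by move=> i; rewrite /f'; case: eqP => // _; exact: bmf_indic.
apply: eq_Rintegral => w _; rewrite (big_setD1 j)//= f'j mulrC; congr (_ * _).
by apply: eq_bigr => i /f'E ->.
Qed.

End product_rule.

Lemma iid_copies_expectation d0 (T0 : measurableType d0) (R : realType)
    (P0 : probability T0 R) (H : {RV P0 >-> R})
    d (T : measurableType d) (P : probability T R) (I : finType)
    (X : I -> {RV P >-> R}) (i : I) (f : R -> R) :
  iid_copies H X -> bounded_mfun_ge0 f -> \int[P]_w f (X i w) = \int[P0]_w f (H w).
Proof.
move=> [_ /(_ i) XH] [mf f0 _].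
have mEf : measurable_fun setT (EFin \o f) by exact/measurable_EFinP.
have Ef0 y : (0 <= (EFin \o f) y)%E by rewrite lee_fin.
rewrite /Rintegral; congr fine.
have := ge0_integral_distribution (X i) mEf Ef0 => /= <-.
have := ge0_integral_distribution H mEf Ef0 => /= <-.
by apply: eq_measure_integral => A mA _; exact: XH.
Qed.

(** * Truncated powers of the weight and their Karamata estimates *)

Section gates.
Variable R : realType.
Implicit Types (x M : R) (p : nat).

(** The gate at 1 makes this nonnegative and bounded on the whole line, although
    the weights only satisfy h >= 1. *)
Definition lower_pow p x (h : R) : R := h ^+ p * \1_(`[1, x]) h.
(** The cap at M keeps the function bounded; for p < alpha - 1 the
    estimates are uniform in M. *)
Definition upper_pow p M x (h : R) : R := Num.min h M ^+ p * \1_(`]x, +oo[) h.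

Lemma lower_powE p x h : 1 <= h -> lower_pow p x h = if h <= x then h ^+ p else 0.
Proof.
move=> h1; rewrite /lower_pow indicE; case: ifPn => hx.
  by rewrite mem_set ?mulr1//= in_itv/= h1.
by rewrite memNset ?mulr0//= in_itv/= h1 (negbTE hx).
Qed.

Lemma upper_powE p M x h : upper_pow p M x h = if x < h then Num.min h M ^+ p else 0.
Proof.
rewrite /upper_pow indicE; case: ifPn => hx.
  by rewrite mem_set ?mulr1//= in_itv/= hx.
by rewrite memNset ?mulr0//= in_itv/= (negbTE hx).
Qed.

Lemma bmf_lower_pow p x : bounded_mfun_ge0 (lower_pow p x).
Proof.
have xE h : lower_pow p x h = if (1 <= h) && (h <= x) then h ^+ p else 0.
  have [h1|h1] /= := leP 1 h; first by rewrite lower_powE.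
  rewrite /lower_pow indicE memNset ?mulr0//= in_itv/=.
  by case: (1 <= h) h1 (lt_geF h1).
split.
- by apply: measurable_funM; [exact: exprn_measurable|exact: measurable_indic].
- by move=> h; rewrite xE; case: ifPn => // /andP[h1 _]; rewrite exprn_ge0// (le_trans ler01).
- exists (`|x| ^+ p) => h; rewrite xE; case: ifPn => [/andP[h1 hx]|_]; last by rewrite exprn_ge0.
  rewrite lerXn2r ?nnegrE ?(le_trans ler01 h1)//.
  by rewrite (le_trans hx) ?ler_norm.
Qed.

Lemma bmf_upper_pow p M x : 0 <= M -> 0 <= x -> bounded_mfun_ge0 (upper_pow p M x).
Proof.
move=> M0 x0; split.
- apply: measurable_funM; last exact: measurable_indic.
  by apply: measurable_funX; exact: measurable_minr.
- move=> h; rewrite upper_powE; case: ifPn => // xh.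
  by rewrite exprn_ge0// le_min M0 andbT (le_trans x0)// ltW.
- exists (M ^+ p) => h; rewrite upper_powE; case: ifPn => [xh|_]; last by rewrite exprn_ge0.
  by rewrite lerXn2r ?nnegrE// ?ge_min ?lexx ?orbT// le_min M0 andbT (le_trans x0)// ltW.
Qed.

End gates.

Section karamata.
Context d0 (T0 : measurableType d0) (R : realType) (P0 : probability T0 R).
Variables (H : {RV P0 >-> R}) (H_ge1 : forall w, 1 <= H w).

Implicit Types (f g : R -> R) (x M : R).

Definition EH (f : R -> R) : R := \int[P0]_w f (H w).

Lemma EH_ge0 f : bounded_mfun_ge0 f -> 0 <= EH f.
Proof. by move=> [_ f0 _]; apply: Rintegral_ge0 => w _. Qed.

Lemma EH_bmf f : bounded_mfun_ge0 f -> bounded_mfun_ge0 (f \o H).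
Proof. by move=> bf; apply: (bmf_comp bf). Qed.

Lemma EH_le f g : bounded_mfun_ge0 f -> bounded_mfun_ge0 g ->
  (forall h, 1 <= h -> f h <= g h) -> EH f <= EH g.
Proof.
by move=> /EH_bmf bf /EH_bmf bg fg; apply: bmf_le => // w; exact: fg.
Qed.

Lemma EH_cst c : EH (cst c) = c.
Proof.
rewrite /EH Rintegral_cst// (_ : _ setT = 1%E) ?mulr1//; exact: probability_setT.
Qed.

Lemma EH_le_lin f g1 g2 c1 c2 : bounded_mfun_ge0 f -> bounded_mfun_ge0 g1 ->
  bounded_mfun_ge0 g2 ->
  (forall h, 1 <= h -> f h <= c1 * g1 h + c2 * g2 h) ->
  EH f <= c1 * EH g1 + c2 * EH g2.
Proof.
move=> /EH_bmf bf /EH_bmf bg1 /EH_bmf bg2 fg.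
have i1 := bmf_integrable P0 bg1; have i2 := bmf_integrable P0 bg2.
have i3 c g : P0.-integrable setT (EFin \o (g \o H)) ->
    P0.-integrable setT (EFin \o (fun w => c * g (H w))).
  move=> ig; rewrite (_ : EFin \o _ = (fun w => c%:E * (EFin \o (g \o H)) w)%E).
    exact: integrableZl.
  by apply/funext => w /=; rewrite EFinM.
rewrite /EH -!RintegralZl// -RintegralD//; [|exact: i3|exact: i3].
apply: le_Rintegral => //; first exact: bmf_integrable.
  exact: (integrableD measurableT (i3 c1 _ i1) (i3 c2 _ i2)).
by move=> w _; exact: fg.
Qed.

(** P(H > x), obtained as the zeroth truncated power so that the comparison
    lemmas for [EH] apply to it. *)
Definition tail x := EH (upper_pow 0 0 x).

Lemma tailE x : tail x = fine (ccdf H x).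
Proof.
rewrite /tail /EH; under eq_Rintegral do rewrite /upper_pow expr0 mul1r.
have mi : measurable (`]x, +oo[ : set R) by [].
have mi' : measurable (H @^-1` `]x, +oo[) by exact: measurable_funPTI.
by rewrite -(Rintegral_indic P0 mi').
Qed.

Lemma tail_ge0 x : 0 <= x -> 0 <= tail x.
Proof. by move=> x0; apply: EH_ge0; exact: bmf_upper_pow. Qed.

Lemma tail_le1 x : 0 <= x -> tail x <= 1.
Proof.
move=> x0; rewrite -[leRHS](EH_cst 1); apply: EH_le; [exact: bmf_upper_pow|exact: bmf_cst|].
by move=> h _; rewrite upper_powE; case: ifP => //=; rewrite expr0.
Qed.

Lemma tail_noninc x y : 0 <= x -> x <= y -> tail y <= tail x.
Proof.
move=> x0 xy; have y0 := le_trans x0 xy.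
apply: EH_le; [exact: bmf_upper_pow|exact: bmf_upper_pow|move=> h _].
rewrite !upper_powE !expr0; case: ifPn => yh; last by case: ifPn.
by rewrite (le_lt_trans xy yh).
Qed.

Variable a : nat.

(** For a = alpha - 1 these are l(x), for x >= 1, and Q(x). *)
Definition slow_part x := x ^+ a * tail x.
Definition trunc_mom x := EH (lower_pow a x).

Variable x0 : R.
Hypothesis x0_ge1 : 1 <= x0.
Hypothesis tail_pos : forall x, 1 <= x -> 0 < tail x.
Hypothesis slow_part_double : forall x, x0 <= x ->
  3 / 4 * slow_part x <= slow_part (2 * x) /\ slow_part (2 * x) <= 3 / 2 * slow_part x.

Let ge0 x : x0 <= x -> 0 <= x.
Proof. by move=> xx; rewrite (le_trans _ xx)// (le_trans _ x0_ge1). Qed.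

Let gt0 x : x0 <= x -> 0 < x.
Proof. by move=> xx; rewrite (lt_le_trans _ xx)// (lt_le_trans _ x0_ge1). Qed.

Lemma slow_part_ge0 x : 0 <= x -> 0 <= slow_part x.
Proof. by move=> xx; rewrite mulr_ge0 ?exprn_ge0 ?tail_ge0. Qed.

(** On the event x/2 < H <= x alone, H^a contributes at least
    (x/2)^a P(x/2 < H <= x) = l(x/2) - l(x) / 2^a, a fixed fraction of l(x) since
    l(x) and l(x/2) are comparable. *)
Lemma slow_part_le_trunc_mom : (2 <= a)%N ->
  forall x, 2 * x0 <= x -> slow_part x <= 3 * trunc_mom x.
Proof.
move=> a2 x hx; pose y := x / 2; have xE : x = 2 * y by rewrite /y; field.
have yx0 : x0 <= y by rewrite /y ler_pdivlMr// mulrC.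
have y0 := ge0 yx0; have yp := gt0 yx0.
have x01 := x0_ge1.
have ya0 : 0 < y ^+ a by rewrite exprn_gt0.
have step : slow_part y <= trunc_mom x + y ^+ a * tail x.
  have -> : trunc_mom x + y ^+ a * tail x = y ^+ a * ((y ^+ a)^-1 * trunc_mom x + 1 * tail x).
    by field; rewrite gt_eqF.
  rewrite ler_pM2l//; apply: EH_le_lin;
    [exact: bmf_upper_pow|exact: bmf_lower_pow|apply: bmf_upper_pow => //; lra|].
  move=> h h1; rewrite !upper_powE !expr0 lower_powE// mul1r.
  have [hlx|hlx] := leP h x; last first.
    by rewrite mulr0 add0r; case: ifP.
  rewrite addr0; case: ifPn => yh; last by rewrite mulr_ge0 ?invr_ge0 ?exprn_ge0//; lra.
  by rewrite mulrC ler_pdivlMr// mul1r lerXn2r ?nnegrE//; lra.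
have Q0 : 0 <= trunc_mom x by apply: EH_ge0; exact: bmf_lower_pow.
have [_] := slow_part_double yx0; rewrite -xE => dbl.
have h4 : 4 * (y ^+ a * tail x) <= slow_part x.
  have -> : slow_part x = 2 ^+ a * (y ^+ a * tail x) by rewrite /slow_part {1}xE exprMn mulrA.
  rewrite ler_wpM2r//.
    by rewrite mulr_ge0 ?exprn_ge0// tail_ge0//; lra.
  have -> : 4 = 2 ^+ 2 :> R by rewrite -natrX.
  by rewrite ler_weXn2l// ler1n.
lra.
Qed.

(** x l(x) grows at least by the factor 3/2 when x doubles, whereas the moment
    up to 2x exceeds the moment up to x by at most 2^(a+1) x l(x): the increments
    are dominated by a geometric series, hence by its last term. *)
Lemma karamata_lower : exists2 C, 0 < C &
  forall x, x0 <= x -> EH (lower_pow a.+1 x) <= C * (x * slow_part x).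
Proof.
have x01 := x0_ge1.
have t0 : 0 < tail (2 * x0) by apply: tail_pos; lra.
(* dividing by tail (2 * x0) makes the bound hold on [x0, 2 * x0] *)
pose C := 2 ^+ a.+2 / tail (2 * x0).
have C4 : 2 ^+ a.+2 <= C.
  by rewrite /C ler_peMr ?exprn_ge0// invf_ge1// tail_le1//; lra.
have C0 : 0 < C by rewrite (lt_le_trans _ C4)// exprn_gt0.
exists C => //.
have base x : x0 <= x -> x <= 2 * x0 -> EH (lower_pow a.+1 x) <= C * (x * slow_part x).
  move=> xx x2; have xp := ge0 xx.
  apply: (@le_trans _ _ ((2 * x0) ^+ a.+1)).
    rewrite -[leRHS]EH_cst; apply: EH_le; [exact: bmf_lower_pow|apply: bmf_cst|].
      by rewrite exprn_ge0//; lra.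
    move=> h h1; rewrite lower_powE//; case: ifPn => hx; last by rewrite exprn_ge0//; lra.
    by rewrite lerXn2r ?nnegrE; lra.
  have -> : C * (x * slow_part x) = 2 ^+ a.+2 * (tail x / tail (2 * x0) * x ^+ a.+1).
    by rewrite /C /slow_part [in x ^+ a.+1]exprS; ring.
  rewrite exprMn ler_pM ?exprn_ge0//; first lra.
    by rewrite ler_eXn2l//; lra.
  rewrite -[leLHS]mul1r ler_pM ?exprn_ge0//; first lra.
    by rewrite ler_pdivlMr// mul1r tail_noninc//; lra.
  by rewrite lerXn2r ?nnegrE//; lra.
have main n x : x0 <= x -> x <= 2 ^+ n.+1 * x0 -> EH (lower_pow a.+1 x) <= C * (x * slow_part x).
  elim: n x => [|n IH] x xx xn; first by apply: base => //; rewrite expr1 in xn.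
  have [x2|x2] := leP x (2 * x0); first exact: base.
  pose y := x / 2; have xE : x = 2 * y by rewrite /y; field.
  have yx0 : x0 <= y by rewrite /y ler_pdivlMr// mulrC ltW.
  have yn : y <= 2 ^+ n.+1 * x0 by rewrite /y ler_pdivrMr// mulrAC -exprSr.
  have y0 := ge0 yx0.
  apply: (@le_trans _ _ (1 * EH (lower_pow a.+1 y) + x ^+ a.+1 * tail y)).
    apply: EH_le_lin; [exact: bmf_lower_pow|exact: bmf_lower_pow|exact: bmf_upper_pow|].
    move=> h h1; rewrite !lower_powE// upper_powE expr0.
    have [hy|hy] := leP h y.
      by rewrite (le_trans hy) ?mulr0 ?addr0 ?mul1r//; lra.
    rewrite mulr0 add0r mulr1; case: ifPn => hx.
      by rewrite lerXn2r ?nnegrE//; lra.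
    by rewrite exprn_ge0//; lra.
  have := IH y yx0 yn; have [dbl _] := slow_part_double yx0.
  have -> : x ^+ a.+1 * tail y = 2 ^+ a.+1 * (y * slow_part y).
    by rewrite xE /slow_part exprMn !exprS; ring.
  move=> IHy; rewrite mul1r [in leRHS]xE.
  have h1 : (C + 2 ^+ a.+1) * (y * slow_part y) <=
            (C + 2 ^+ a.+1) * (4 / 3 * (y * slow_part (2 * y))).
    rewrite ler_wpM2l//; first by rewrite addr_ge0 ?exprn_ge0// ltW.
    by rewrite [leRHS]mulrCA ler_wpM2l//; lra.
  have h2 : (C + 2 ^+ a.+1) * (4 / 3 * (y * slow_part (2 * y))) <= C * (2 * y * slow_part (2 * y)).
    have -> : C * (2 * y * slow_part (2 * y)) = C * (3 / 2) * (4 / 3 * (y * slow_part (2 * y))).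
      by field.
    rewrite ler_wpM2r//.
      by apply: mulr_ge0; [lra|rewrite mulr_ge0 ?slow_part_ge0// mulr_ge0].
    have : 2 ^+ a.+1 * 2 <= C by rewrite -exprSr.
    lra.
  lra.
move=> x xx.
apply: (main (Num.bound x)) => //.
have h2 : x < 2 ^+ (Num.bound x).+1 by apply: upper_nthrootP.
by rewrite (le_trans (ltW h2))// ler_peMr// exprn_ge0.
Qed.

(** Dually, l(x) / x = x^b P(H > x) shrinks at least by the factor 3/4 when x
    doubles, so the contributions of the intervals between 2^i x and 2^(i+1) x
    sum to a multiple of the first one. The induction is on the number of
    doublings needed to pass the cap M; the constant does not depend on it. *)
Lemma karamata_upper b : a = b.+1 -> exists2 C, 0 < C &
  forall x M, x0 <= x -> 0 <= M -> EH (upper_pow b M x) <= C * (slow_part x / x).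
Proof.
move=> ab; exists (4 * 2 ^+ b) => [|x M xx M0]; first by rewrite mulr_gt0// exprn_gt0.
have LE y : 0 < y -> slow_part y / y = y ^+ b * tail y.
  by move=> y0; rewrite /slow_part ab exprS; field; rewrite gt_eqF.
suff main n : forall x, x0 <= x -> M <= 2 ^+ n * x ->
    EH (upper_pow b M x) <= 4 * 2 ^+ b * (x ^+ b * tail x).
  rewrite LE ?gt0//; apply: (main (Num.bound M)) => //.
  have h2 : M < 2 ^+ Num.bound M by apply: upper_nthrootP.
  rewrite (le_trans (ltW h2))// ler_peMr// ?exprn_ge0//.
  exact: le_trans xx.
elim: n {x xx} => [|n IH] x xx Mx.
  have xp := gt0 xx.
  apply: (@le_trans _ _ (x ^+ b * tail x + 0 * tail x)).
    apply: EH_le_lin; [exact/bmf_upper_pow/ltW|exact/bmf_upper_pow/ltW|exact/bmf_upper_pow/ltW|].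
    move=> h h1; rewrite mul0r addr0 !upper_powE expr0; case: ifPn => xh; last by rewrite mulr0.
    rewrite mulr1 lerXn2r ?nnegrE//; [|exact: ltW|].
      by rewrite le_min M0 (le_trans ler01).
    by rewrite ge_min (le_trans Mx) ?expr0 ?mul1r ?lexx ?orbT.
  rewrite mul0r addr0 ler_peMl ?mulr_ge0 ?exprn_ge0 ?tail_ge0 ?(ltW xp)//.
  have : 1 <= 2 ^+ b :> R by rewrite exprn_ege1// ler1n.
  lra.
have xp := gt0 xx; have x2 : x0 <= 2 * x by lra.
apply: (@le_trans _ _ ((2 * x) ^+ b * tail x + 1 * EH (upper_pow b M (2 * x)))).
  apply: EH_le_lin;
    [exact/bmf_upper_pow/ltW|exact/bmf_upper_pow/ltW|apply: bmf_upper_pow => //; lra|].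
  move=> h h1; rewrite !upper_powE expr0; case: ifPn => xh; last first.
    by rewrite mulr0 add0r mul1r ifN// -leNgt; lra.
  rewrite mulr1 mul1r; case: ifPn => [_|]; first by rewrite lerDr exprn_ge0//; lra.
  rewrite -leNgt addr0 => hx; rewrite lerXn2r ?nnegrE//; [|lra|].
    by rewrite le_min M0 (le_trans ler01).
  by rewrite ge_min hx.
have := IH _ x2; rewrite mulrA -exprSr => /(_ Mx).
have [_] := slow_part_double xx.
have -> : slow_part (2 * x) = (2 * x) * ((2 * x) ^+ b * tail (2 * x)).
  by rewrite /slow_part ab exprS mulrA.
have -> : slow_part x = x * (x ^+ b * tail x) by rewrite /slow_part ab exprS mulrA.
rewrite !exprMn => dbl IHx.
have {}dbl : 2 ^+ b * x ^+ b * tail (2 * x) <= 3 / 4 * (x ^+ b * tail x).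
  rewrite -(@ler_pM2l _ (2 * x)); [lra|lra].
have : 4 * 2 ^+ b * (2 ^+ b * x ^+ b * tail (2 * x)) <=
       4 * 2 ^+ b * (3 / 4 * (x ^+ b * tail x)).
  by rewrite ler_wpM2l// mulr_ge0// exprn_ge0.
lra.
Qed.

End karamata.

(** * The mean weight and the slowly varying function *)

Section mean.
Context d0 (T0 : measurableType d0) (R : realType) (P0 : probability T0 R).
Variables (H : {RV P0 >-> R}) (H_ge1 : forall w, 1 <= H w).
Local Notation EH := (EH H).
Implicit Types (x M : R).

Lemma truncated_momentE p x : truncated_moment H p x = EH (lower_pow (p - 1) x).
Proof.
have [mf f0 _] := bmf_lower_pow (p - 1) x.
have mEf : measurable_fun setT (EFin \o lower_pow (p - 1) x) by exact/measurable_EFinP.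
have Ef0 y : (0 <= (EFin \o lower_pow (p - 1) x) y)%E by rewrite lee_fin.
rewrite /truncated_moment Rintegral_mkcond /Rintegral /EH /Rintegral; congr fine.
have := ge0_integral_distribution H mEf Ef0 => /= <-.
apply: eq_integral => h _ /=; congr EFin.
by rewrite /lower_pow patch_indic.
Qed.

Lemma slowly_varying_double (l : R -> R) : slowly_varying l ->
  exists2 x0 : R, 1 <= x0 &
    forall x, x0 <= x -> 3 / 4 * l x <= l (2 * x) /\ l (2 * x) <= 3 / 2 * l x.
Proof.
move=> [l0 /(_ 2 (ltr0n _ 2))] /cvgrPdist_le /(_ (1 / 4)).
have e0 : 0 < 1 / 4 :> R by rewrite divr_gt0.
move=> /(_ e0) [M [_ HM]]; exists (Num.max 1 (M + 1)); first by rewrite le_max lexx.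
move=> x; rewrite ge_max => /andP[x1 xM].
have := HM x; rewrite (lt_le_trans _ xM) ?ltrDl// => /(_ isT).
have lx := l0 x x1; rewrite ler_norml lerBrDr lerBlDr.
move eq_q : (l (2 * x) / l x) => q /andP[q1 q2].
have -> : l (2 * x) = q * l x by rewrite -eq_q divfK// gt_eqF.
by split; rewrite ler_pM2r//; lra.
Qed.

Variable b : nat.
Hypothesis b_gt0 : (0 < b)%N.
Variables (x0 C : R).
Hypothesis x0_ge1 : 1 <= x0.
Hypothesis hK : forall M, 0 <= M -> EH (upper_pow b M x0) <= C.

Lemma capped_moment_bounded M : 0 <= M -> EH (upper_pow b M 0) <= x0 ^+ b + C.
Proof.
move=> M0; have x01 := x0_ge1.
apply: (@le_trans _ _ (x0 ^+ b * EH (cst 1) + 1 * EH (upper_pow b M x0))).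
  apply: EH_le_lin => //; [exact: bmf_upper_pow|exact: bmf_cst|apply: bmf_upper_pow => //; lra|].
  move=> h h1; rewrite !upper_powE /= mulr1 mul1r ifT; last by lra.
  case: ifPn => hx; first by rewrite lerDr exprn_ge0//; lra.
  rewrite addr0 lerXn2r ?nnegrE//; [|lra|].
    by rewrite le_min M0 andbT; lra.
  by rewrite ge_min leNgt hx.
by rewrite EH_cst mulr1 mul1r lerD2l hK.
Qed.

(** The content is finiteness, since fine maps an infinite mean to 0. The capped
    means are at most the capped moments of order b >= 1, hence bounded, and they
    increase to the mean. *)
Lemma mean_fin_ge1 : 1 <= fine ('E_P0[H])%E.
Proof.
have x01 := x0_ge1.
pose g n w : \bar R := (upper_pow 1 n%:R 0 (H w))%:E.
have gE n w : g n w = (Num.min (H w) n%:R)%:E.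
  by rewrite /g upper_powE expr1 (lt_le_trans ltr01).
have bh n : bounded_mfun_ge0 (upper_pow 1 (n%:R : R) 0) by exact: bmf_upper_pow.
have mg n : measurable_fun setT (g n).
  by apply/measurable_EFinP; have [] := EH_bmf H (bh n).
have g0 n w : setT w -> (0 <= g n w)%E.
  by move=> _; rewrite lee_fin; have [_ + _] := bh n; exact.
have gnd w : setT w -> nondecreasing_seq (g ^~ w).
  move=> _ m n mn; rewrite !gE lee_fin ge_min; apply/orP.
  have [hm|hm] := leP (H w) m%:R.
    by left; rewrite le_min lexx (le_trans hm)// ler_nat.
  by right; rewrite le_min (ltW hm) ler_nat.
have := @cvg_monotone_convergence _ _ _ P0 _ measurableT _ mg g0 gnd.
have -> : (\int[P0]_w limn (g ^~ w) = 'E_P0[H])%E.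
  rewrite expectation_def; apply: eq_integral => w _.
  apply/cvg_lim => //; apply: cvg_near_cst.
  exists (Num.bound (H w)) => // n /= nH; rewrite gE; congr EFin.
  apply/min_idPl; have Hw0 : 0 <= H w by rewrite (le_trans ler01).
  by rewrite (le_trans (ltW (archi_boundP Hw0)))// ler_nat.
move=> cvE.
have Efin : ('E_P0[H] <= (x0 ^+ b + C)%:E)%E.
  rewrite -(cvg_lim _ cvE)//; apply: lime_le; first by apply/cvg_ex; exists 'E_P0[H]%E.
  apply: nearW => n; rewrite /g.
  have := bmf_EFin_Rintegral P0 (EH_bmf H (bh n)) => /= <-.
  rewrite lee_fin (le_trans _ (capped_moment_bounded (ler0n R n)))//.
  apply: EH_le => //; [exact: bmf_upper_pow|move=> h h1].
  rewrite !upper_powE (lt_le_trans ltr01 h1) expr1.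
  case: n => [|n]; first by rewrite min_r ?expr0n ?gtn_eqF// (le_trans ler01).
  rewrite -[leLHS]expr1 ler_weXn2l// le_min h1/= ler1n//.
have E1 : (1%:E <= 'E_P0[H])%E.
  rewrite -(expectation_cst P0); apply: expectation_le => //.
  - by move=> w; rewrite (le_trans ler01).
  - exact: aeW.
have Ef : 'E_P0[H]%E \is a fin_num.
  by rewrite fin_numElt (lt_le_trans _ E1) ?ltNyr// (le_lt_trans Efin) ?ltry.
by rewrite -lee_fin fineK.
Qed.

End mean.

(** * Distributing edge bounds over nodes *)

Section pairs.
Variables (R : realType) (n : nat).
Implicit Types (V S J : {set 'I_n}) (a : 'I_n -> 'I_n -> R).

Definition edges V : {set 'I_n * 'I_n} :=
  [set p | [&& p.1 \in V, p.2 \in V & (p.1 < p.2)%N]]%SET.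

(** On the left every pair is visited once and collects what it charges to both of
    its ends; on the right it is visited from each end. *)
Lemma prod_edges V a :
  \prod_(p in edges V) (a p.1 p.2 * a p.2 p.1) =
  \prod_(i in V) \prod_(j in V :\ i) a i j.
Proof.
rewrite big_split/= pair_big_dep/=.
rewrite [RHS](bigID (fun p : 'I_n * 'I_n => (p.1 < p.2)%N))/=; congr (_ * _).
  apply: eq_bigl => -[i j]; rewrite !inE /= -val_eqE/=.
  by have [ij|ij] := ltnP i j; rewrite ?andbF// gtn_eqF// !andbT.
have swapK : involutive (fun p : 'I_n * 'I_n => (p.2, p.1)) by case.
rewrite (reindex_inj (inv_inj swapK))/=.
apply: eq_bigl => -[i j]; rewrite !inE /= -val_eqE/=.
by case: ltngtP => ij; case: (i \in V); case: (j \in V).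
Qed.

Lemma prod_if_const V J (c : R) (i : 'I_n) : J \subset V -> i \notin J ->
  \prod_(j in V :\ i) (if j \in J then c else 1) = c ^+ #|J|.
Proof.
move=> JV iJ; rewrite -big_mkcondr/= -prodr_const; apply: eq_bigl => j.
rewrite !inE; have [jJ|] := boolP (j \in J); last by rewrite andbF.
by rewrite (fintype.subsetP JV)// !andbT; apply: contraNneq iJ => <-.
Qed.

(** The part of the bound on the edge {i, j} that is charged to its endpoint i,
    for S the set of heavy nodes and J the light nodes to which the heavy nodes
    use their edges. *)
Definition share S J (r M : R) (x : 'I_n -> R) (i j : 'I_n) : R :=
  if i \in S then (if j \in J then Num.min (x i) M / r else 1)
  else if (i \in J) || (j \notin S) then x i / r else 1.

(** A heavy node uses its |J| edges to J, a node of J all its edges, and any other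
    light node its edges to the light nodes. *)
Lemma prod_share V S J r M x i : S \subset V -> J \subset V :\: S -> i \in V ->
  \prod_(j in V :\ i) share S J r M x i j =
  if i \in S then (Num.min (x i) M / r) ^+ #|J|
  else if i \in J then (x i / r) ^+ #|V|.-1
  else (x i / r) ^+ #|V :\: S|.-1.
Proof.
move=> SV JV iV; rewrite /share; case: ifPn => iS.
  apply: prod_if_const; first exact: fintype.subset_trans JV (finset.subsetDl _ _).
  by apply/negP => /(fintype.subsetP JV); rewrite !inE iS.
case: ifPn => iJ /=; first by rewrite prodr_const (cardsD1 i V) iV.
have -> : #|V :\: S|.-1 = #|(V :\: S) :\ i|.
  by rewrite (cardsD1 i (V :\: S)) !inE iS iV.
rewrite -(@prod_if_const V ((V :\: S) :\ i) (x i / r) i); first last.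
- by rewrite !inE eqxx.
- by apply/fintype.subsetP => j; rewrite !inE => /andP[_ /andP[]].
apply: eq_bigr => j; rewrite !inE => /andP[-> ->].
by rewrite andbT.
Qed.

Lemma edge_prob_le1 (mu x y : R) : edge_prob mu n x y <= 1.
Proof. by rewrite /edge_prob ge_min lexx orbT. Qed.

Lemma edge_prob_le_prod (mu x y : R) : 1 <= mu -> 0 <= x -> 0 <= y ->
  edge_prob mu n x y <= x * y / n%:R.
Proof.
move=> mu1 x0 y0; have mu0 : 0 < mu by rewrite (lt_le_trans ltr01).
rewrite /edge_prob ge_min; apply/orP; left; rewrite ler_wpM2l ?mulr_ge0//.
have [->|n0] := posnP n; first by rewrite mulr0.
by rewrite lef_pV2 ?posrE ?mulr_gt0 ?ltr0n// ler_peMl.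
Qed.

(** If u > n, the truncated bound is v >= 1, above any probability. *)
Lemma edge_prob_le_min (mu x y u v : R) : (0 < n)%N -> 1 <= v ->
  edge_prob mu n x y <= u * v / n%:R ->
  edge_prob mu n x y <= Num.min u n%:R * v / n%:R.
Proof.
move=> n0 v1 le_uv; have [un|nu] := leP u n%:R; first by [].
by rewrite mulrAC divff ?gt_eqF ?ltr0n// mul1r (le_trans (edge_prob_le1 _ _ _)).
Qed.

Lemma edge_prob_le_share (mu r : R) S J x i j : 1 <= mu -> 1 <= r ->
  r ^+ 2 = n%:R -> 1 <= x i -> 1 <= x j -> J \subset ~: S ->
  edge_prob mu n (x i) (x j) <=
  share S J r n%:R x i j * share S J r n%:R x j i.
Proof.
move=> mu1 r1 rn xi xj JS.
have JnS l : l \in J -> l \notin S by move/(fintype.subsetP JS); rewrite inE.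
have r0 : 0 < r by rewrite (lt_le_trans ltr01).
have n0 : (0 < n)%N by rewrite -(ltr0n R) -rn exprn_gt0.
have le1 := edge_prob_le1 mu (x i) (x j).
have lep : edge_prob mu n (x i) (x j) <= x i * x j / n%:R.
  by apply: edge_prob_le_prod => //; rewrite (le_trans ler01).
have prodE (u v : R) : u / r * (v / r) = u * v / n%:R.
  by rewrite -rn; field; rewrite gt_eqF.
rewrite /share; have [iS|iS] := boolP (i \in S); have [jS|jS] := boolP (j \in S).
- by rewrite !ifN ?mulr1//; apply/negP => /JnS; rewrite ?iS ?jS.
- rewrite /= !orbF; case: ifPn => jJ; rewrite ?prodE ?mulr1//.
  exact: edge_prob_le_min.
- rewrite /= !orbF; case: ifPn => iJ; rewrite ?prodE ?mulr1//.
  by rewrite [x i * _]mulrC; apply: edge_prob_le_min => //; rewrite [x j * _]mulrC.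
- by rewrite !orbT prodE.
Qed.

Lemma edge_prob_le_capped (mu r x y : R) : 1 <= mu -> 1 <= r ->
  r ^+ 2 = n%:R -> 1 <= x -> 1 <= y ->
  edge_prob mu n x y <= Num.min x n%:R / r * (Num.min y n%:R / r).
Proof.
move=> mu1 r1 rn x1 y1; have r0 : 0 < r by rewrite (lt_le_trans ltr01).
have n0 : (0 < n)%N by rewrite -(ltr0n R) -rn exprn_gt0.
have -> : Num.min x n%:R / r * (Num.min y n%:R / r) =
    Num.min y n%:R * Num.min x n%:R / n%:R.
  by rewrite -rn; field; rewrite gt_eqF.
apply: edge_prob_le_min => //; first by rewrite le_min x1 ler1n.
rewrite [y * _]mulrC; apply: edge_prob_le_min => //.
by apply: edge_prob_le_prod => //; rewrite (le_trans ler01).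
Qed.

End pairs.

(** * The contribution of a single node *)

Lemma subset_of_card (T : finType) (A : {set T}) (m : nat) :
  exists2 B : {set T}, B \subset A & #|B| = minn #|A| m.
Proof.
exists [set x in take m (enum A)]%SET.
  by apply/fintype.subsetP => x; rewrite inE => /mem_take; rewrite mem_enum.
rewrite cardsE (card_uniqP _) ?take_uniq ?enum_uniq// size_take -cardE.
by rewrite minnC.
Qed.

Section scaling.
Variable R : realType.
Implicit Types (r M h : R) (p q : nat).

Lemma upper_pow_scale p M r h : r < h ->
  upper_pow p M r h / r ^+ p = (Num.min h M / r) ^+ p.
Proof. by move=> rh; rewrite upper_powE rh expr_div_n. Qed.

Lemma lower_pow_scale p r h : 1 <= h -> h <= r -> lower_pow p r h / r ^+ p = (h / r) ^+ p.
Proof. by move=> h1 hr; rewrite lower_powE// hr expr_div_n. Qed.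

(** Above r the ratio of the weight to r is at least 1, so raising the exponent
    increases its power; below r it decreases it. This reduces all exponents
    to a - 1, a and a + 1, where the moment estimates are available. *)
Lemma upper_pow_scale_mono p q M r h : (p <= q)%N -> 0 < r -> r <= M ->
  upper_pow p M r h / r ^+ p <= upper_pow q M r h / r ^+ q.
Proof.
move=> pq r0 rM; have [rh|hr] := ltP r h; last by rewrite !upper_powE !ifN -?leNgt// !mul0r.
rewrite !upper_pow_scale// ler_weXn2l// ler_pdivlMr// mul1r.
by rewrite le_min rM ltW.
Qed.

Lemma lower_pow_scale_mono p q r h : (q <= p)%N -> 0 < r -> 1 <= h ->
  lower_pow p r h / r ^+ p <= lower_pow q r h / r ^+ q.
Proof.
move=> pq r0 h1; have [hr|rh] := leP h r; last by rewrite !lower_powE// !ifN -?ltNge// !mul0r.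
have h0 : 0 <= h by rewrite (le_trans ler01).
rewrite !lower_pow_scale// ler_wiXn2l//.
  by rewrite divr_ge0// ltW.
by rewrite ler_pdivrMr// mul1r.
Qed.

End scaling.

Lemma bmf_divr (R : realType) (f : R -> R) (c : R) :
  bounded_mfun_ge0 f -> 0 <= c -> bounded_mfun_ge0 (fun h => f h / c).
Proof.
move=> bf c0; have c' : bounded_mfun_ge0 (cst c^-1 : R -> R) by apply: bmf_cst; rewrite invr_ge0.
exact: (bmfM bf c').
Qed.

Section factors.
Variables (R : realType) (n : nat).
Implicit Types (V S J : {set 'I_n}).

(** The product of the shares of node i, as a function of its weight, gated to
    the side of r on which S puts node i. *)
Definition node_factor V S J (r M : R) (i : 'I_n) (h : R) : R :=
  if i \in S then upper_pow #|J| M r h / r ^+ #|J|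
  else if i \in J then lower_pow #|V|.-1 r h / r ^+ #|V|.-1
  else lower_pow #|V :\: S|.-1 r h / r ^+ #|V :\: S|.-1.

Lemma bmf_node_factor V S J (r M : R) i : 1 <= r -> 0 <= M ->
  bounded_mfun_ge0 (node_factor V S J r M i).
Proof.
move=> r1 M0; have r0 : 0 <= r by rewrite (le_trans ler01).
rewrite /node_factor; case: (i \in S); last case: (i \in J).
- by apply: bmf_divr; [exact: bmf_upper_pow|exact: exprn_ge0].
- by apply: bmf_divr; [exact: bmf_lower_pow|exact: exprn_ge0].
- by apply: bmf_divr; [exact: bmf_lower_pow|exact: exprn_ge0].
Qed.

(** The term indexed by the set of nodes heavier than r is already a bound;
    summing over all S gives a fixed function of the weights, each term of which
    is a product over the nodes. *)
Lemma prod_edge_prob_le V (K : {set 'I_n} -> {set 'I_n}) (mu r : R) (x : 'I_n -> R) :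
  1 <= mu -> 1 <= r -> r ^+ 2 = n%:R -> (forall i, i \in V -> 1 <= x i) ->
  (forall S, S \subset V -> K S \subset V :\: S) ->
  \prod_(p in edges V) edge_prob mu n (x p.1) (x p.2) <=
  \sum_(S in powerset V) \prod_(i in V) node_factor V S (K S) r n%:R i (x i).
Proof.
move=> mu1 r1 rn x1 KV.
have M0 : 0 <= n%:R :> R by [].
pose S := [set i in V | r < x i]%SET.
have SV : S \subset V by apply/fintype.subsetP => i; rewrite inE => /andP[].
rewrite (bigD1 S) ?finset.powersetE//=; apply: ler_wpDr.
  apply: sumr_ge0 => S' _; apply: prodr_ge0 => i _.
  by have [_ + _] := bmf_node_factor V S' (K S') i r1 M0; exact.
have KS : K S \subset ~: S.
  by apply: fintype.subset_trans (KV _ SV) _; rewrite finset.setDE finset.subsetIr.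
have -> : \prod_(i in V) node_factor V S (K S) r n%:R i (x i) =
    \prod_(i in V) \prod_(j in V :\ i) share S (K S) r n%:R x i j.
  apply: eq_bigr => i iV; rewrite prod_share ?KV// /node_factor.
  case: ifPn => [|iS]; first by rewrite inE => /andP[_ ?]; rewrite upper_pow_scale.
  have xr : x i <= r by move: iS; rewrite inE iV /= -leNgt.
  by case: ifPn => _; rewrite lower_pow_scale ?x1.
rewrite -prod_edges; apply: ler_prod => -[i j]; rewrite inE /= => /and3P[iV jV _].
rewrite edge_prob_le_share ?x1// andbT.
have mu0 : 0 < mu by rewrite (lt_le_trans ltr01).
rewrite /edge_prob le_min ler01 andbT divr_ge0 ?mulr_ge0// ?(ltW mu0)//.
  by rewrite (le_trans ler01)// x1.
by rewrite (le_trans ler01)// x1.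
Qed.

End factors.

Section factor_expectation.
Context d0 (T0 : measurableType d0) (R : realType) (P0 : probability T0 R).
Variables (H : {RV P0 >-> R}) (H_ge1 : forall w, 1 <= H w).
Local Notation EH := (EH H).

Lemma EH_divr (f : R -> R) c : bounded_mfun_ge0 f -> EH (fun h => f h / c) = EH f / c.
Proof.
by move=> /(EH_bmf H) bf; rewrite /EH RintegralZr//; exact: bmf_integrable.
Qed.

(** B stands for l(r) if k > alpha and for Q(r) if k = alpha. A heavy node with
    |J| = a has capped moment at most Q(n) + n^a P(H > n) = Q(n) + l(n), hence
    at most 4 Q(n). A light node outside J exists only if t > a, so that its exponent
    t - 1 is at least a. *)
Lemma EH_node_factor_le (a n : nat) (V S J : {set 'I_n}) (r M B C1 C2 : R) (i : 'I_n) :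
  (0 < a)%N -> (a < #|V|)%N ->
  1 <= r -> r <= M -> S \subset V -> J \subset V :\: S ->
  #|J| = minn #|V :\: S| a -> i \in V -> 
  0 <= B -> slow_part H a r <= 3 * B -> slow_part H a M <= 3 * trunc_mom H a M ->
  0 <= C1 -> EH (lower_pow #|V|.-1 r) / r ^+ #|V|.-1 <= C1 * (B / r ^+ a) ->
  0 <= C2 -> EH (upper_pow a.-1 M r) <= C2 * (slow_part H a r / r) ->
  EH (node_factor V S J r M i) <= (4 + 3 * C2 + C1) *
    ((if (i \in J) || (#|J| < a)%N then B else trunc_mom H a M) / r ^+ a).
Proof.
move=> a0 aV r1 rM SV JV cJ iV B0 LB LQ C10 hC1 C20 hC2.
have r0 : 0 < r by rewrite (lt_le_trans ltr01).
have M0 : 0 <= M by rewrite (le_trans _ rM)// ltW.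
have D0 y : 0 <= y -> y <= 4 + 3 * C2 + C1 -> forall z, 0 <= z ->
  y * z <= (4 + 3 * C2 + C1) * z by move=> *; rewrite ler_wpM2r.
have ra0 : 0 < r ^+ a by rewrite exprn_gt0.
have Q0 : 0 <= trunc_mom H a M by apply: EH_ge0; exact: bmf_lower_pow.
have Bz : 0 <= B / r ^+ a by rewrite divr_ge0// ltW.
have Qz : 0 <= trunc_mom H a M / r ^+ a by rewrite divr_ge0// ltW.
have [iS|iS] := boolP (i \in S).
  have iJ : i \notin J by apply/negP => /(fintype.subsetP JV); rewrite inE iS.
  rewrite (negbTE iJ) /=.
  have -> : node_factor V S J r M i = fun h => upper_pow #|J| M r h / r ^+ #|J|.
    by apply/funext => h; rewrite /node_factor iS.
  case: ifPn => Ja; last first.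
    have {Ja cJ} -> : #|J| = a.
      by apply/eqP; rewrite eqn_leq [(a <= _)%N]leqNgt Ja andbT cJ geq_minr.
    rewrite EH_divr; last by apply: bmf_upper_pow => //; exact: ltW.
    apply: (@le_trans _ _ (4 * (trunc_mom H a M / r ^+ a))); last by apply: D0 => //; lra.
    rewrite mulrA ler_wpM2r ?invr_ge0 ?(ltW ra0)//.
    apply: (@le_trans _ _ (1 * trunc_mom H a M + M ^+ a * tail H M)); last first.
      by move: LQ; rewrite {1}/slow_part; lra.
    apply: EH_le_lin => //; [exact/bmf_upper_pow/ltW|exact: bmf_lower_pow|exact: bmf_upper_pow|].
    move=> h h1; rewrite !upper_powE lower_powE// expr0 mul1r.
    have h0 : 0 <= h by rewrite (le_trans ler01).
    have [hM|Mh] := leP h M.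
      by rewrite mulr0 addr0; case: ifP => // _; rewrite exprn_ge0.
    by rewrite add0r mulr1; case: ifP => // _; rewrite exprn_ge0.
  have rb0 : 0 < r ^+ a.-1 by rewrite exprn_gt0.
  have h1 : EH (fun h => upper_pow #|J| M r h / r ^+ #|J|) <=
            EH (fun h => upper_pow a.-1 M r h / r ^+ a.-1).
    apply: EH_le => //.
    - by apply: bmf_divr; [apply: bmf_upper_pow => //|apply: exprn_ge0]; exact: ltW.
    - by apply: bmf_divr; [apply: bmf_upper_pow => //|apply: exprn_ge0]; exact: ltW.
    by move=> h _; apply: upper_pow_scale_mono => //; rewrite -ltnS prednK.
  apply: (le_trans h1); rewrite EH_divr; last by apply: bmf_upper_pow => //; exact: ltW.
  apply: (@le_trans _ _ (3 * C2 * (B / r ^+ a))); last by apply: D0 => //; lra.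
  rewrite -[in leRHS](prednK a0) exprS ler_pdivrMr// (le_trans hC2)//.
  have -> : 3 * C2 * (B / (r * r ^+ a.-1)) * r ^+ a.-1 = C2 * (3 * B / r).
    by field; rewrite !gt_eqF.
  by rewrite ler_wpM2l// ler_wpM2r// invr_ge0 ltW.
have [iJ|iJ] /= := boolP (i \in J).
  have -> : node_factor V S J r M i = fun h => lower_pow #|V|.-1 r h / r ^+ #|V|.-1.
    by apply/funext => h; rewrite /node_factor (negbTE iS) iJ.
  rewrite EH_divr; last exact: bmf_lower_pow.
  by apply: (le_trans hC1); apply: D0 => //; lra.
have JVS : (#|J| < #|V :\: S|)%N.
  apply: proper_card; rewrite properE JV /=; apply/fintype.subsetPn.
  by exists i => //; rewrite inE iS iV.
have aVS : (a < #|V :\: S|)%N by move: JVS; rewrite cJ gtn_min ltnn.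
rewrite ifN; last by rewrite -leqNgt cJ leq_min leqnn (ltnW aVS).
have -> : node_factor V S J r M i = fun h => lower_pow #|V :\: S|.-1 r h / r ^+ #|V :\: S|.-1.
  by apply/funext => h; rewrite /node_factor (negbTE iS) (negbTE iJ).
apply: (@le_trans _ _ (EH (fun h => lower_pow a r h / r ^+ a))).
  apply: EH_le => //.
  - by apply: bmf_divr; [exact: bmf_lower_pow|apply: exprn_ge0; exact: ltW].
  - by apply: bmf_divr; [exact: bmf_lower_pow|apply: exprn_ge0; exact: ltW].
  by move=> h h1; apply: lower_pow_scale_mono => //; rewrite -ltnS (ltn_predK aVS).
rewrite EH_divr; last exact: bmf_lower_pow.
apply: (@le_trans _ _ (1 * (trunc_mom H a M / r ^+ a))); last by apply: D0 => //; lra.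
rewrite mul1r ler_wpM2r ?invr_ge0 ?(ltW ra0)//.
apply: EH_le => //; [exact: bmf_lower_pow|exact: bmf_lower_pow|move=> h h1].
rewrite !lower_powE//; case: ifPn => hr; first by rewrite (le_trans hr).
by case: ifP => // _; rewrite exprn_ge0// (le_trans ler01).
Qed.

End factor_expectation.

(** * The clique probability *)

Lemma bmf_ae_le d (T : measurableType d) (R : realType) (P : probability T R)
    (f g : T -> R) : bounded_mfun_ge0 f -> bounded_mfun_ge0 g ->
  {ae P, forall w, f w <= g w} ->
  \int[P]_w f w <= \int[P]_w g w.
Proof.
move=> bf bg fg; rewrite -lee_fin.
have := bmf_EFin_Rintegral P bf => /= ->.
have := bmf_EFin_Rintegral P bg => /= ->.
have [mf f0 _] := bf; have [mg g0 _] := bg.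
by have := expectation_le mf mg f0 g0 fg; rewrite unlock.
Qed.

Definition clique_set (k n : nat) : {set 'I_n} := [set i : 'I_n | (i < k)%N]%SET.

Lemma card_clique_set k n : (k <= n)%N -> #|clique_set k n| = k.
Proof.
move=> kn; rewrite -sum1_card (eq_bigl (fun i : 'I_n => (i < k)%N)).
  by rewrite -(big_ord_widen n (fun _ => 1%N) kn) sum1_card card_ord.
by move=> i; rewrite inE.
Qed.

Lemma clique_eventE (T : Type) (k n : nat) (G : T -> rel 'I_n) :
  (forall w, symmetric (G w)) ->
  clique_event k G =
  \bigcap_(p in [set` edges (clique_set k n)]) [set w | G w p.1 p.2].
Proof.
move=> Gsym; apply/seteqP; split => w /= h.
  move=> [i j] /=; rewrite !inE /= => /and3P[ik jk ij].
  by apply: h; rewrite ?inE// -val_eqE/= ltn_eqF.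
move=> i j; rewrite !inE => ik jk nij.
have [ij|ji] : (i < j)%N \/ (j < i)%N by apply/orP; rewrite -neq_ltn.
  by apply: (h (i, j)); rewrite /= !inE /= ik jk.
by rewrite Gsym; apply: (h (j, i)); rewrite /= !inE /= ik jk.
Qed.

Section clique_probability.
Context d0 (T0 : measurableType d0) (R : realType) (P0 : probability T0 R).
Variables (H : {RV P0 >-> R}) (H_ge1 : forall w, 1 <= H w).
Context d (T : measurableType d) (P : probability T R).
Variables (mu : R) (k n : nat) (W : 'I_n -> {RV P >-> R}) (G : T -> rel 'I_n).
Hypothesis mu_ge1 : 1 <= mu.
Hypothesis cl : chung_lu H mu W G.
Hypothesis n_gt0 : (0 < n)%N.
Local Notation V := (clique_set k n).
Local Notation EH := (EH H).

Lemma weights_ge1 : {ae P, forall w, forall i, 1 <= W i w}.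
Proof.
have [[_ dW] _ _ _] := cl.
apply: filter_forall => i.
exists (W i @^-1` `]-oo, 1[); split.
- exact: measurable_funPTI.
- have m1 : measurable (`]-oo, 1[ : set R) by [].
  have := dW i _ m1; rewrite /distribution /pushforward => ->.
  rewrite (_ : _ @^-1` _ = set0) ?measure0// -subset0 => w /=.
  by rewrite in_itv/= ltNge H_ge1.
- by move=> w /=; rewrite in_itv/= => /negP; rewrite -ltNge.
Qed.

(** Each edge probability is clipped at 0, because weights below 1, possible on a
    null set, could make it negative. *)
Let p w := \prod_(e in edges V) Num.max 0 (edge_prob mu n (W e.1 w) (W e.2 w)).

Lemma measurable_edge_prob i j :
  measurable_fun setT (fun w => edge_prob mu n (W i w) (W j w)).
Proof.
have mW l : measurable_fun setT (W l : T -> R) by [].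
by apply: measurable_minr => //; apply: measurable_funM => //; exact: measurable_funM.
Qed.

Let bp : bounded_mfun_ge0 p.
Proof.
apply: bmf_prod => e _; split.
- by apply: measurable_maxr => //; exact: measurable_edge_prob.
- by move=> w; rewrite le_max lexx.
- by exists 1 => w; rewrite ge_max ler01 /edge_prob ge_min lexx orbT.
Qed.

Let pE w : (forall i, 1 <= W i w) ->
  p w = \prod_(e in edges V) edge_prob mu n (W e.1 w) (W e.2 w).
Proof.
move=> w1; apply: eq_bigr => e _; apply/max_idPr.
have mu0 : 0 <= mu by rewrite (le_trans ler01).
have w0 i : 0 <= W i w by rewrite (le_trans ler01).
by rewrite /edge_prob le_min ler01 andbT divr_ge0 ?mulr_ge0.
Qed.

Lemma clique_probE :
  P (clique_event k G) = (\int[P]_w (p w)%:E)%E.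
Proof.
have [_ Gsi mG condP] := cl.
rewrite clique_eventE; last by move=> w; have [] := Gsi w.
have ltE e : e \in edges V -> (e.1 < e.2)%N by rewrite inE => /and3P[].
have [mc intc] := condP (edges V) ltE.
have sT : sigma_generated W setT.
  by apply: sub_sigma_algebra; exists (Ordinal n_gt0), setT.
have := intc _ sT; rewrite setTI => ->.
apply: ae_eq_integral => //.
- apply/measurable_EFinP => _ B mB; rewrite setTI.
  apply: smallest_sub (mc _ mB); first exact: sigma_algebra_measurable.
  by move=> _ [i [A [mA ->]]]; exact: measurable_funPTI.
- by apply/measurable_EFinP; have [] := bp.
- by apply: filterS weights_ge1 => w w1 _; rewrite pE.
Qed.

Lemma clique_prob_le (g : ('I_n -> R) -> R) : bounded_mfun_ge0 (fun w => g (W^~ w)) ->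
  (forall x, (forall i, 1 <= x i) ->
    \prod_(e in edges V) edge_prob mu n (x e.1) (x e.2) <= g x) ->
  fine (P (clique_event k G)) <= \int[P]_w g (W^~ w).
Proof.
move=> bg pg; rewrite clique_probE -/(Rintegral _ _ _).
apply: bmf_ae_le => //; apply: filterS weights_ge1 => w w1 /=.
by rewrite -/(p w) pE//; exact: (pg (W^~ w)).
Qed.

Lemma clique_prob_ge (c : R) : 0 <= c ->
  (forall x, (forall i, 1 <= x i) ->
    c <= \prod_(e in edges V) edge_prob mu n (x e.1) (x e.2)) ->
  c <= fine (P (clique_event k G)).
Proof.
move=> c0 pc; rewrite clique_probE -/(Rintegral _ _ _).
apply: (@le_trans _ _ (\int[P]_w (cst c w))).
  rewrite Rintegral_cst// (_ : _ setT = 1%E) ?mulr1//; exact: probability_setT.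
apply: bmf_ae_le => //; first exact: bmf_cst.
by apply: filterS weights_ge1 => w w1 /=; rewrite -/(p w) pE//; exact: (pc (W^~ w)).
Qed.

Lemma weights_expectation_prod (f : 'I_n -> R -> R) : (forall i, bounded_mfun_ge0 (f i)) ->
  \int[P]_w (\prod_(i in V) f i (W i w)) = \prod_(i in V) EH (f i).
Proof.
have [iid _ _ _] := cl; have [indW _] := iid.
move=> bf; rewrite independent_expectation_prod//.
by apply: eq_bigr => i _; exact: (iid_copies_expectation i iid (bf i)).
Qed.

Variable r : R.
Hypothesis r_ge1 : 1 <= r.
Hypothesis rn : r ^+ 2 = n%:R.
Hypothesis kn : (k <= n)%N.

Lemma clique_prob_le_moment b C : (k.-1 <= b)%N ->
  (forall M, 0 <= M -> EH (upper_pow b M 0) <= C) ->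
  fine (P (clique_event k G)) <= (C / r ^+ k.-1) ^+ k.
Proof.
move=> kb hC; have r0 : 0 < r by rewrite (lt_le_trans ltr01).
have n1 : 1 <= n%:R :> R by rewrite ler1n.
pose f (i : 'I_n) h := upper_pow k.-1 n%:R 0 h / r ^+ k.-1.
have bf i : bounded_mfun_ge0 (f i) by apply: bmf_divr; [exact: bmf_upper_pow|exact/exprn_ge0/ltW].
apply: (@le_trans _ _ (\int[P]_w (\prod_(i in V) f i (W i w)))).
  apply: (clique_prob_le (g := fun x => \prod_(i in V) f i (x i))) => [|x x1].
    by apply: bmf_prod => i _; exact: (bmf_comp (bf i)).
  have -> : \prod_(i in V) f i (x i) =
      \prod_(i in V) \prod_(j in V :\ i) (Num.min (x i) n%:R / r).
    apply: eq_bigr => i iV; rewrite /f upper_powE ifT ?(lt_le_trans ltr01)//.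
    rewrite prodr_const -expr_div_n; congr (_ ^+ _).
    by rewrite -[in LHS](card_clique_set kn) (cardsD1 i V) iV.
  rewrite -prod_edges; apply: ler_prod => e _.
  rewrite edge_prob_le_capped// andbT /edge_prob le_min ler01 andbT.
  by rewrite divr_ge0 ?mulr_ge0// ?(le_trans ler01).
rewrite weights_expectation_prod//.
have -> : (C / r ^+ k.-1) ^+ k = \prod_(i in V) (C / r ^+ k.-1).
  by rewrite prodr_const card_clique_set.
apply: ler_prod => i _; rewrite EH_ge0//=.
rewrite (_ : f i = fun h => upper_pow k.-1 n%:R 0 h / r ^+ k.-1)//.
rewrite EH_divr; last exact: bmf_upper_pow.
rewrite ler_wpM2r ?invr_ge0 ?exprn_ge0 ?(ltW r0)//.
apply: le_trans (hC _ (ler0n R n)).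
apply: EH_le => //; [exact: bmf_upper_pow|exact: bmf_upper_pow|move=> h h1].
rewrite !upper_powE (lt_le_trans ltr01 h1) ler_weXn2l//.
by rewrite le_min h1.
Qed.

Lemma clique_prob_ge_power :
  ((Num.sqrt mu * r)^-1 ^+ k.-1) ^+ k <= fine (P (clique_event k G)).
Proof.
have r0 : 0 < r by rewrite (lt_le_trans ltr01).
have mu0 : 0 < mu by rewrite (lt_le_trans ltr01).
have sr0 : 0 < Num.sqrt mu * r by rewrite mulr_gt0// sqrtr_gt0.
apply: clique_prob_ge => [|x x1].
  by rewrite !exprn_ge0// invr_ge0 ltW.
pose c (i j : 'I_n) := (Num.sqrt mu * r)^-1.
have -> : ((Num.sqrt mu * r)^-1 ^+ k.-1) ^+ k =
    \prod_(i in V) \prod_(j in V :\ i) c i j.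
  transitivity (\prod_(i in V) (Num.sqrt mu * r)^-1 ^+ k.-1).
    by rewrite prodr_const card_clique_set.
  apply: eq_bigr => i iV; rewrite prodr_const; congr (_ ^+ _).
  by rewrite -[in LHS](card_clique_set kn) (cardsD1 i V) iV.
rewrite -prod_edges; apply: ler_prod => e _.
rewrite /c mulr_ge0 ?invr_ge0 ?(ltW sr0)//=.
have -> : (Num.sqrt mu * r)^-1 * (Num.sqrt mu * r)^-1 = (mu * n%:R)^-1.
  by rewrite -rn -[in RHS](sqr_sqrtr (ltW mu0)); field; rewrite !gt_eqF ?sqrtr_gt0.
have mn : 1 <= mu * n%:R.
  by rewrite -[leLHS]mulr1 ler_pM// ler1n.
rewrite /edge_prob le_min; apply/andP; split.
  by rewrite ler_peMl ?invr_ge0 ?mulr_ge0 ?(ltW mu0)// -[leLHS]mulr1 ler_pM.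
by rewrite invf_le1// (lt_le_trans ltr01).
Qed.

(** Summing over the 2^k possible sets S of heavy nodes; K S is the set called J
    above. *)
Lemma clique_prob_le_split a B C1 C2 : (0 < a)%N -> (a < k)%N ->
  0 <= B -> slow_part H a r <= 3 * B -> slow_part H a n%:R <= 3 * trunc_mom H a n%:R ->
  B <= 3 * trunc_mom H a n%:R ->
  0 <= C1 -> EH (lower_pow k.-1 r) / r ^+ k.-1 <= C1 * (B / r ^+ a) ->
  0 <= C2 -> EH (upper_pow a.-1 n%:R r) <= C2 * (slow_part H a r / r) ->
  fine (P (clique_event k G)) <=
  2 ^+ k * (3 * (4 + 3 * C2 + C1)) ^+ k *
  ((r ^+ a)^-1 ^+ k * B ^+ a * trunc_mom H a n%:R ^+ (k - a)).
Proof.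
move=> a0 ak B0 LB LQ BQ C10 hC1 C20 hC2.
have r0 : 0 < r by rewrite (lt_le_trans ltr01).
have r1 := r_ge1.
have n1 : 1 <= n%:R :> R by rewrite ler1n.
have rM : r <= n%:R by rewrite -rn expr2 ler_peMl// ltW.
have Vk := card_clique_set kn.
have /choice[K HK] S : exists K : {set 'I_n}, K \subset V :\: S /\ #|K| = minn #|V :\: S| a.
  by have [K] := subset_of_card (V :\: S) a; exists K.
pose f S := node_factor V S (K S) r n%:R.
have bf S i : bounded_mfun_ge0 (f S i) by apply: bmf_node_factor.
pose F S w := \prod_(i in V) f S i (W i w).
have bF S : bounded_mfun_ge0 (F S) by apply: bmf_prod => i _; exact: (bmf_comp (bf S i)).
pose Q := trunc_mom H a n%:R.
have Q0 : 0 <= Q by apply: EH_ge0; exact: bmf_lower_pow.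
pose D := 4 + 3 * C2 + C1.
have D0 : 0 <= D by rewrite /D; lra.
have DE : D = 4 + 3 * C2 + C1 by [].
have ra0 : 0 <= (r ^+ a)^-1 by rewrite invr_ge0 exprn_ge0// ltW.
pose E : seq {set 'I_n} := enum (powerset V).
apply: (@le_trans _ _ (\int[P]_w (\sum_(S <- E) F S w))).
  apply: (clique_prob_le (g := fun x => \sum_(S <- E) \prod_(i in V) f S i (x i))).
    exact: (bmf_sum _ bF).
  move=> x x1; rewrite /E big_enum/=; apply: prod_edge_prob_le => // S _.
  by have [] := HK S.
rewrite (Rintegral_bmf_sum P _ bF) /E big_enum/=.
have step (S : {set 'I_n}) : S \subset V -> \int[P]_w F S w <=
    (3 * D) ^+ k * ((r ^+ a)^-1 ^+ k * B ^+ a * Q ^+ (k - a)).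
  move=> SV; have [KV cK] := HK S.
  rewrite weights_expectation_prod//.
  pose b i := if (i \in K S) || (#|K S| < a)%N then B else Q.
  have b0 i : 0 <= b i by rewrite /b; case: ifP.
  have Kle : #|K S| = a \/ (#|K S| < a)%N.
    by move: (geq_minr #|V :\: S| a); rewrite -cK leq_eqVlt => /predU1P.
  have prodb : \prod_(i in V) b i <= 3 ^+ k * (B ^+ a * Q ^+ (k - a)).
    have KV' : K S \subset V by apply: fintype.subset_trans KV (finset.subsetDl _ _).
    have BQ0 : 0 <= B ^+ a * Q ^+ (k - a) by rewrite mulr_ge0 ?exprn_ge0.
    case: Kle => [Ka|Ka].
      apply: (@le_trans _ _ (B ^+ a * Q ^+ (k - a))); last first.
        by rewrite ler_peMl// exprn_ege1// ler1n.
      have -> : (k - a = #|V :\: K S|)%N.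
        by rewrite cardsD (finset.setIidPr KV') Vk Ka.
      rewrite (big_setID (K S))/= (finset.setIidPr KV') -[in leRHS]Ka -!prodr_const.
      rewrite le_eqVlt; apply/orP; left; apply/eqP; congr (_ * _).
        by apply: eq_bigr => i iK; rewrite /b iK.
      apply: eq_bigr => i; rewrite inE /b => /andP[/negbTE -> _].
      by rewrite Ka ltnn.
    (* fewer than a light nodes: every node contributes B *)
    rewrite (eq_bigr (fun=> B)); last by move=> i _; rewrite /b Ka orbT.
    rewrite prodr_const Vk -{1}(subnKC (ltnW ak)) exprD mulrCA ler_wpM2l ?exprn_ge0//.
    apply: (@le_trans _ _ ((3 * Q) ^+ (k - a))).
      by rewrite lerXn2r ?nnegrE// mulr_ge0.
    rewrite exprMn ler_wpM2r ?exprn_ge0// ler_weXn2l ?leq_subr//.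
    by rewrite ler1n.
  apply: (@le_trans _ _ (\prod_(i in V) (D * (b i / r ^+ a)))).
    apply: ler_prod => i iV; rewrite EH_ge0//=.
    by apply: EH_node_factor_le; rewrite ?Vk.
  rewrite big_split big_split/= !prodr_const Vk.
  have -> : (3 * D) ^+ k * ((r ^+ a)^-1 ^+ k * B ^+ a * Q ^+ (k - a)) =
      D ^+ k * ((3 ^+ k * (B ^+ a * Q ^+ (k - a))) * (r ^+ a)^-1 ^+ k).
    by rewrite exprMn; ring.
  by rewrite ler_wpM2l ?exprn_ge0// ler_wpM2r// exprn_ge0.
apply: (@le_trans _ _ (\sum_(S in powerset V)
    (3 * D) ^+ k * ((r ^+ a)^-1 ^+ k * B ^+ a * Q ^+ (k - a)))).
  by apply: ler_sum => S; rewrite finset.powersetE; exact: step.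
rewrite big_const iter_addr_0 card_powerset Vk -[leLHS]mulr_natl natrX /Q -DE.
by rewrite -!mulrA.
Qed.

End clique_probability.

(** * The asymptotic statement *)

Lemma lesssim_of_le (R : realType) (f g : nat -> R) (D : R) (N : nat) : 0 < D ->
  (forall n, (N < n)%N -> 0 <= g n) -> (forall n, (N < n)%N -> f n <= D * g n) ->
  lesssim f g.
Proof.
move=> D0 g0 fg; exists N, (fun n => D * g n); split => //.
exists N, D, (D + 1); split => //; split; first by rewrite ltrDl.
by move=> n Nn; split=> //; rewrite ler_wpM2r ?g0// lerDl.
Qed.

Lemma powR_sqr (R : realType) (r : R) (k m : nat) : 0 <= r ->
  (r ^+ 2) `^ (k%:R / 2 * (1 - m.+1%:R)) = (r ^+ m)^-1 ^+ k.
Proof.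
move=> r0; rewrite -(powR_mulrn 2 r0) -powRrM.
have -> : 2 * (k%:R / 2 * (1 - m.+1%:R)) = - (m * k)%:R :> R.
  by rewrite natrM -natr1; field.
by rewrite powRN powR_mulrn// exprM exprVn.
Qed.

Theorem theorem4p1 (R : realType) (alpha k : nat)
  (halpha : (2 < alpha)%N) (hk : (2 <= k)%N)
  (l : R -> R) (hl : slowly_varying l)
  (d0 : measure_display) (T0 : measurableType d0) (P0 : probability T0 R)
  (H : {RV P0 >-> R})
  (H_ge1 : forall w : T0, 1 <= H w)
  (H_tail : forall h : R, 1 <= h ->
     ccdf H h = (h `^ (1 - alpha%:R) * l h)%:E)
  (d : nat -> measure_display) (T : forall n : nat, measurableType (d n))
  (P : forall n : nat, probability (T n) R)
  (W : forall n : nat, 'I_n -> {RV (P n) >-> R})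
  (G : forall n : nat, T n -> rel 'I_n)
  (hG : forall n : nat, (k <= n)%N ->
     chung_lu H (fine 'E_P0[H]) (@W n) (@G n)) :
  let Q := truncated_moment H alpha in
  let pK := fun n : nat => fine (P n (clique_event k (@G n))) in
  [/\ (k < alpha)%N ->
        asymp pK (fun n => n%:R `^ (k%:R / 2 * (1 - k%:R))),
      k = alpha ->
        lesssim pK (fun n => n%:R `^ (k%:R / 2 * (1 - k%:R)) *
          Q (Num.sqrt n%:R) ^+ (k - 1) * Q n%:R) &
      (alpha < k)%N ->
        lesssim pK (fun n => n%:R `^ (k%:R / 2 * (1 - alpha%:R)) *
          l (Num.sqrt n%:R) ^+ (alpha - 1) * Q n%:R ^+ (k - alpha + 1))].
Proof.
move=> Q pK; set mu := fine 'E_P0[H]%E in hG.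
pose a := (alpha - 1)%N; have a2 : (2 <= a)%N by rewrite /a; case: (alpha) halpha => [|[|[|]]].
have aE : alpha = a.+1 by rewrite /a subn1 prednK// (leq_trans _ halpha).
have [l0 _] := hl.
have lE x : 1 <= x -> slow_part H a x = l x.
  move=> x1; have xp : 0 < x by rewrite (lt_le_trans ltr01).
  rewrite /slow_part tailE H_tail//= aE -natr1 opprD addrCA subrr addr0.
  by rewrite powRN powR_mulrn ?(ltW xp)// mulrA divff ?mul1r// expf_neq0// gt_eqF.
have tail_pos x : 1 <= x -> 0 < tail H x.
  move=> x1; have := l0 x x1; rewrite -lE// /slow_part pmulr_rgt0// exprn_gt0//.
  by rewrite (lt_le_trans ltr01).
have [x0 x0_ge1 dbl] := slowly_varying_double hl.
have slow_part_double x : x0 <= x -> 3 / 4 * slow_part H a x <= slow_part H a (2 * x) /\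
    slow_part H a (2 * x) <= 3 / 2 * slow_part H a x.
  move=> xx; have x1 := le_trans x0_ge1 xx.
  by rewrite !lE//; [exact: dbl|lra].
have [C1 C1_gt0 HC1] := karamata_lower H_ge1 x0_ge1 tail_pos slow_part_double.
have [C2 C2_gt0 HC2] := karamata_upper H_ge1 x0_ge1 slow_part_double (esym (prednK (ltnW a2))).
have LQ := slow_part_le_trunc_mom H_ge1 x0_ge1 slow_part_double a2.
have b0 : (0 < a.-1)%N by rewrite -ltnS prednK// ltnW.
pose C3 := C2 * (slow_part H a x0 / x0).
have HC3 M : 0 <= M -> EH H (upper_pow a.-1 M x0) <= C3 by move=> M0; apply: HC2.
have mu1 : 1 <= mu by apply: (mean_fin_ge1 H_ge1 b0 x0_ge1 HC3).
have cap := capped_moment_bounded H_ge1 x0_ge1 HC3.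
pose N := (k + Num.bound (4 * x0 ^+ 2))%N.
pose r (n : nat) : R := Num.sqrt n%:R.
have rn n : r n ^+ 2 = n%:R by rewrite /r sqr_sqrtr.
have big n : (N < n)%N -> [/\ 2 * x0 <= r n, 2 * x0 <= n%:R, (k <= n)%N & (0 < n)%N].
  move=> Nn; have kn : (k <= n)%N by rewrite ltnW// (leq_trans _ Nn)// ltnS leq_addr.
  have h1 : 4 * x0 ^+ 2 <= n%:R.
    apply: (le_trans (ltW (archi_boundP _))); first by rewrite mulr_ge0// exprn_ge0//; lra.
    by rewrite ler_nat ltnW// (leq_trans _ Nn)// ltnS leq_addl.
  have h2 : 2 * x0 <= r n.
    rewrite -(@ler_pXn2r _ 2) ?nnegrE ?sqrtr_ge0//; last lra.
    by rewrite rn exprMn -natrX.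
  split=> //; last by rewrite (leq_trans _ kn)// ltnW.
  by rewrite (le_trans h2)// -rn expr2 ler_peMl ?sqrtr_ge0//; lra.
have r_ge1 n : 2 * x0 <= r n -> 1 <= r n by move=> h; lra.
have powE n m : n%:R `^ (k%:R / 2 * (1 - m.+1%:R)) = (r n ^+ m)^-1 ^+ k.
  by rewrite -rn powR_sqr// sqrtr_ge0.
have QE x : Q x = trunc_mom H a x by rewrite /Q truncated_momentE.
have Q0 x : 0 <= trunc_mom H a x by apply: EH_ge0; exact: bmf_lower_pow.
have Qmono n : 1 <= r n -> trunc_mom H a (r n) <= trunc_mom H a n%:R.
  move=> r1; apply: EH_le => //; [exact: bmf_lower_pow|exact: bmf_lower_pow|move=> h h1].
  have rnn : r n <= n%:R by rewrite -rn expr2 ler_peMl// sqrtr_ge0.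
  rewrite !lower_powE//; case: ifPn => hr; first by rewrite (le_trans hr).
  by case: ifP => // _; rewrite exprn_ge0// (le_trans ler01).
have Lt0 x : 1 <= x -> 0 < slow_part H a x by move=> x1; rewrite lE// l0.
have kE : k = k.-1.+1 by rewrite prednK// ltnW.
split.
- move=> ka.
  pose c := ((Num.sqrt mu)^-1 ^+ k.-1) ^+ k; pose C := x0 ^+ a.-1 + C3.
  have c0 : 0 < c by rewrite !exprn_gt0// invr_gt0 sqrtr_gt0; lra.
  have C0 : 0 < C.
    rewrite ltr_wpDr// ?exprn_gt0//; last lra.
    by rewrite /C3 mulr_ge0 ?divr_ge0 ?(ltW C2_gt0) ?(ltW (Lt0 _ x0_ge1))//; lra.
  exists N, c, (c + C ^+ k); split => //; split; first by rewrite ltrDl exprn_gt0.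
  move=> n /big[rx nx kn n0]; have r1 := r_ge1 _ rx.
  rewrite [X in 1 - X%:R]kE powE.
  have r0 : 0 <= (r n ^+ k.-1)^-1 ^+ k by rewrite exprn_ge0// invr_ge0 exprn_ge0//; lra.
  split.
    apply: le_trans (clique_prob_ge_power H_ge1 mu1 (hG n kn) n0 r1 (rn n) kn).
    by rewrite /c -exprMn -exprVn -exprMn -invfM.
  have kb : (k.-1 <= a.-1)%N by rewrite -ltnS -kE (prednK (ltnW a2)) -ltnS -aE.
  apply: (le_trans (clique_prob_le_moment H_ge1 mu1 (hG n kn) n0 r1 (rn n) kn kb cap)).
  by rewrite exprMn ler_wpM2r// lerDr ltW.
- move=> ka; have ak : a = k.-1 by rewrite ka aE.
  apply: (@lesssim_of_le _ _ _ (2 ^+ k * (3 * (4 + 3 * C2 + 1)) ^+ k) N).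
  + by rewrite mulr_gt0// exprn_gt0//; lra.
  + by move=> n _; rewrite !QE !mulr_ge0 ?exprn_ge0 ?powR_ge0.
  move=> n /big[rx nx kn n0]; have r1 := r_ge1 _ rx.
  have Lr := LQ _ rx; have Ln := LQ _ nx.
  have rx0 : x0 <= r n by lra.
  have QQ : trunc_mom H a (r n) <= 3 * trunc_mom H a n%:R.
    by have := Qmono _ r1; have := Q0 n%:R; lra.
  have hC1 : EH H (lower_pow k.-1 (r n)) / r n ^+ k.-1 <= 1 * (trunc_mom H a (r n) / r n ^+ a).
    by rewrite mul1r -ak.
  have hC2 := HC2 _ _ rx0 (ler0n R n).
  have ak' : (a < k)%N by rewrite ak -kE.
  have := clique_prob_le_split H_ge1 mu1 (hG n kn) n0 r1 (rn n) kn (ltnW a2) ak'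
    (Q0 _) Lr Ln QQ ler01 hC1 (ltW C2_gt0) hC2.
  rewrite !QE [X in 1 - X%:R]kE powE.
  have -> : (k - a = 1)%N by rewrite ak kE subSnn.
  have -> : (k - 1 = a)%N by rewrite ak subn1.
  by rewrite ak expr1.
- move=> ak.
  apply: (@lesssim_of_le _ _ _ (2 ^+ k * (3 * (4 + 3 * C2 + C1)) ^+ k) N).
  + by rewrite mulr_gt0// exprn_gt0//; lra.
  + move=> n /big[rx _ _ _]; rewrite QE !mulr_ge0 ?exprn_ge0 ?powR_ge0//.
    by apply/ltW/l0; exact: r_ge1.
  move=> n /big[rx nx kn n0]; have r1 := r_ge1 _ rx.
  have rp : 0 < r n by lra.
  have Lr := LQ _ rx; have Ln := LQ _ nx.
  have rx0 : x0 <= r n by lra.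
  have L0 := Lt0 _ r1.
  have LB : slow_part H a (r n) <= 3 * slow_part H a (r n) by lra.
  have BQ : slow_part H a (r n) <= 3 * trunc_mom H a n%:R by have := Qmono _ r1; lra.
  have hC1 : EH H (lower_pow k.-1 (r n)) / r n ^+ k.-1 <= C1 * (slow_part H a (r n) / r n ^+ a).
    have rk p : 0 <= r n ^+ p by rewrite exprn_ge0// ltW.
    rewrite -EH_divr; last exact: bmf_lower_pow.
    apply: (@le_trans _ _ (EH H (fun h => lower_pow a.+1 (r n) h / r n ^+ a.+1))).
      apply: EH_le => //;
        [exact: bmf_divr (bmf_lower_pow _ _) (rk _)|exact: bmf_divr (bmf_lower_pow _ _) (rk _)|].
      by move=> h h1; apply: lower_pow_scale_mono => //; rewrite -aE -ltnS -kE.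
    rewrite EH_divr; last exact: bmf_lower_pow.
    rewrite ler_pdivrMr ?exprn_gt0// (le_trans (HC1 _ rx0))// exprS.
    rewrite le_eqVlt; apply/orP; left; apply/eqP; field.
    by rewrite expf_neq0// gt_eqF.
  have hC2 := HC2 _ _ rx0 (ler0n R n).
  have ak' : (a < k)%N by rewrite -aE ltnW.
  have := clique_prob_le_split H_ge1 mu1 (hG n kn) n0 r1 (rn n) kn (ltnW a2) ak'
    (ltW L0) LB Ln BQ (ltW C1_gt0) hC1 (ltW C2_gt0) hC2.
  rewrite QE [X in 1 - X%:R]aE powE (lE _ r1).
  have -> // : (k - a = k - alpha + 1)%N.
  by rewrite aE addn1 subnSK.
Qed.
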